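(* Let $n\ge 3$ and let $h:\mathbb{B}^n\to(-1,1)$ be a harmonic function. Then for every $x\in\mathbb{B}^n$, $$|\nabla h(x)|\le\frac{n}{2}\,\frac{1-|h(x)|^2}{1-|x|}.$$ In addition, this inequality is strict for $n\ge 4$.
   Context: $\mathbb{B}^n$ is the open unit ball of $\mathbb{R}^n$ and $|\cdot|$ the Euclidean norm. *)

(* Defs.v *)
From HB Require Import structures.
From mathcomp Require Import all_boot all_order all_algebra.
From mathcomp Require Import all_classical all_reals all_analysis.

Set Implicit Arguments.
Unset Strict Implicit.
Unset Printing Implicit Defensive.
Import Order.TTheory GRing.Theory Num.Theory.
Import numFieldNormedType.Exports.

Local Open Scope classical_set_scope.
Local Open Scope ring_scope.

(* The library norm on 'rV[R]_n is the sup norm, hence the need for [enorm].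
   The two norms are equivalent, so limits, continuity and derivatives below
   can use the library's topology on 'rV[R]_n. *)
Definition enorm (R : realType) (n : nat) (x : 'rV[R]_n) : R :=
  Num.sqrt (\sum_(i < n) x ord0 i ^+ 2).

Definition unit_ball (R : realType) (n : nat) : set 'rV[R]_n :=
  [set x | enorm x < 1].
Arguments unit_ball : clear implicits.

Definition partial (R : realType) (n : nat) (i : 'I_n) (f : 'rV[R]_n -> R) :
    'rV[R]_n -> R :=
  fun x => 'D_(delta_mx ord0 i) f x.

Definition grad (R : realType) (n : nat) (f : 'rV[R]_n -> R) (x : 'rV[R]_n) :
    'rV[R]_n :=
  \row_(i < n) partial i f x.

Definition laplacian (R : realType) (n : nat) (f : 'rV[R]_n -> R) :
    'rV[R]_n -> R :=
  fun x => \sum_(i < n) partial i (partial i f) x.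

(* [C1_on U f] and [C2_on U f] are meant for open U: existence and continuity
   of the partial derivatives at a point of U then depend only on the
   restriction of f to U. *)
Definition C1_on (R : realType) (n : nat) (U : set 'rV[R]_n)
    (f : 'rV[R]_n -> R) : Prop :=
  forall x, U x -> {for x, continuous f} /\
    forall i : 'I_n, derivable f x (delta_mx ord0 i) /\
                     {for x, continuous (partial i f)}.

Definition C2_on (R : realType) (n : nat) (U : set 'rV[R]_n)
    (f : 'rV[R]_n -> R) : Prop :=
  C1_on U f /\ forall i : 'I_n, C1_on U (partial i f).

Definition harmonic_on (R : realType) (n : nat) (U : set 'rV[R]_n)
    (f : 'rV[R]_n -> R) : Prop :=
  C2_on U f /\ forall x, U x -> laplacian f x = 0.

(* Main.v *)
Require Import Defs.
From HB Require Import structures.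
From mathcomp Require Import all_boot all_order all_algebra.
From mathcomp Require Import all_classical all_reals all_analysis.
From mathcomp Require Import ring lra zify.
Set Implicit Arguments.
Unset Strict Implicit.
Unset Printing Implicit Defensive.
Import Order.TTheory GRing.Theory Num.Theory.
Import numFieldNormedType.Exports.
Local Open Scope classical_set_scope.
Local Open Scope ring_scope.

(** The ball of centre [x] and radius [1 - |x|] lies in the unit ball, so it is
enough to bound the gradient of a harmonic [u] at the centre of the unit ball:
if [|u| < 1] and [e] is a unit vector, then
  [d_e u(0) <= n/2 (1 - u(0)^2) - (n - 3) (1 - |u(0)|)^2 / 4],
and the last term is what makes the inequality strict for [n >= 4].

With [s = <y, e>] and [t = -u(0)], the mean value property would give
  [d_e u(0) / n - t u(0) = E (s - t) u <= E |s - t|],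
where [E] is the average over the unit sphere.  In dimension 3 the coordinate
[s] is uniform on [[-1, 1]] by Archimedes' theorem, so the right-hand side is
[(1 + t^2) / 2], which is the claim.  In higher dimension the law of [s] is
symmetric and unimodal, that is, a mixture of uniform laws on smaller centred
intervals; none of them has a larger [E |s - t|], and the second moment
[E s^2 = 1/n], at most the 1/3 of the uniform law, measures the gain.

No integral over the sphere is used: the maximum principle replaces it.  Let
[p >= |s - t|] on [[-1, 1]] be a polynomial.
- [sphere_extends_poly] gives a harmonic polynomial [P] with [P = p(s)] on the
  sphere; its value at 0 is the average of [p], which is defined algebraically
  by the moments ([sphmean]).  It is enough to treat the Gegenbauer
  polynomials, which span all others.
- The harmonic function with the boundary values of [s u] is
  [s u + (1 - |y|^2) v], where [v] is harmonic and [n v + 2 y.grad v = d_e u],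
  so that [v(0) = d_e u(0) / n].  [approx_gradient_field] builds [v] up to an
  error: a Riemann sum of dilations of a difference quotient of [u] replaces
  the integral that solves the equation, so that [u] is never differentiated
  more than twice.
- [center_derivative_le] applies the maximum principle to
  [(s - t) u + (1 - |y|^2) v - P], which is at most 0 on the sphere, and
  obtains [d_e u(0) / n - t u(0) <= P(0)].

[exists_majorant] takes for [p] the Bernstein polynomial of [|s - t|], which
is above it by convexity.  The average of [p] is then a finite sum
over equidistant nodes, with weights that are symmetric and unimodal
([bern_weight_sym], [bern_weight_le]); the mixture argument becomes a
summation by parts ([sum_unimodal_ge0]). *)

(** * Averages of polynomials over the sphere *)

(** The moments of one coordinate of a uniform point of the unit sphere in
dimension [m + 3]; the recursion is [sphmean_divergence] for monomials. *)
Fixpoint moment (R : realFieldType) (m k : nat) : R :=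
  match k with
  | 0 => 1
  | 1 => 0
  | k'.+2 => k'.+1%:R / (k' + m.+3)%:R * moment R m k'
  end.

Definition sphmean (R : realFieldType) (m : nat) (p : {poly R}) : R :=
  \sum_(i < size p) p`_i * moment R m i.

Lemma sphmeanE (R : realFieldType) (m d : nat) (p : {poly R}) :
  (size p <= d)%N -> sphmean m p = \sum_(i < d) p`_i * moment R m i.
Proof.
move=> le_pd; rewrite /sphmean (big_ord_widen _ (fun i => p`_i * moment R m i) le_pd).
rewrite big_mkcond; apply: eq_bigr => i _.
by case: ltnP => // le_pi; rewrite nth_default ?mul0r.
Qed.

Lemma sphmean_is_linear (R : realFieldType) (m : nat) :
  linear_for *%R (@sphmean R m).
Proof.
move=> a p q; set d := maxn (size p) (size q).
have le_pd : (size p <= d)%N by exact: leq_maxl.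
have le_qd : (size q <= d)%N by exact: leq_maxr.
have le_d : (size (a *: p + q)%R <= d)%N.
  apply: leq_trans (size_polyD _ _) _; rewrite geq_max le_qd andbT.
  exact: leq_trans (size_scale_leq _ _) le_pd.
rewrite !(@sphmeanE _ _ d)// mulr_sumr -big_split/=; apply: eq_bigr => i _.
by rewrite coefD coefZ mulrDl mulrA.
Qed.

HB.instance Definition _ (R : realFieldType) (m : nat) :=
  GRing.isLinear.Build R {poly R} R *%R (@sphmean R m) (@sphmean_is_linear R m).

Lemma sphmeanZ (R : realFieldType) (m : nat) (a : R) (p : {poly R}) :
  sphmean m (a *: p) = a * sphmean m p.
Proof. exact: linearZ. Qed.

Lemma sphmeanB (R : realFieldType) (m : nat) (p q : {poly R}) :
  sphmean m (p - q) = sphmean m p - sphmean m q.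
Proof. exact: linearB. Qed.

Lemma sphmeanXn (R : realFieldType) (m k : nat) :
  sphmean m ('X^k : {poly R}) = moment R m k.
Proof.
rewrite (@sphmeanE _ _ k.+1) ?size_polyXn// big_ord_recr/= coefXn eqxx mul1r.
by rewrite big1 ?add0r// => i _; rewrite coefXn ltn_eqF// mul0r.
Qed.

Lemma sphmean1 (R : realFieldType) (m : nat) : sphmean m (1 : {poly R}) = 1.
Proof. by rewrite -[1](expr0 'X) sphmeanXn. Qed.

(** The polynomial is the divergence along the sphere of [f(s)] times the
tangential gradient of the coordinate [s], hence it has average 0.  With the
moments as definition, the identity needs a proof for monomials only. *)
Lemma sphmean_divergence (R : realFieldType) (m : nat) (f : {poly R}) :
  sphmean m ((1 - 'X ^+ 2) * f^`() - m.+2%:R *: ('X * f)) = 0.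
Proof.
have mono k : sphmean m ((1 - 'X ^+ 2) * ('X^k : {poly R})^`()
      - m.+2%:R *: ('X * 'X^k)) = 0.
  case: k => [|k].
    by rewrite expr0 derivC mulr0 mulr1 sphmeanB linear0 sphmeanZ -['X]expr1
      sphmeanXn mulr0 subrr.
  rewrite derivXn /= -mulr_natl -polyC_natr mulrBl mul1r !mul_polyC.
  rewrite -scalerAr -exprD -exprS !sphmeanB !sphmeanZ !sphmeanXn /=.
  rewrite !add0n; field.
  by rewrite -!natrD pnatr_eq0; lia.
have ef : f = \sum_(i < size f) f`_i *: 'X^i by rewrite -poly_def coefK.
rewrite {1 2}ef.
rewrite linear_sum !mulr_sumr scaler_sumr -sumrB linear_sum big1//= => i _.
rewrite derivZ -!scalerAr [_ *: (f`_i *: _)]scalerA [m.+2%:R * _]mulrC -scalerA.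
by rewrite -scalerBr sphmeanZ mono mulr0.
Qed.

(** * Gegenbauer polynomials *)

Definition gegen_coef (R : realFieldType) (m k : nat) : R := (k * (k + m))%:R.

(** The pair of consecutive terms makes the two-step recurrence structural.
The first component is [k!] times the classical Gegenbauer polynomial of
degree [k] and parameter [(m + 1) / 2], a normalization without division. *)
Fixpoint gegen_pair (R : realFieldType) (m k : nat) : {poly R} * {poly R} :=
  match k with
  | 0 => (1, 0)
  | k'.+1 => let pq := gegen_pair R m k' in
     ((k'.*2 + m.+1)%:R *: ('X * pq.1) - gegen_coef R m k' *: pq.2, pq.1)
  end.

Definition gegen (R : realFieldType) (m k : nat) : {poly R} :=
  (gegen_pair R m k).1.

Lemma gegen0 (R : realFieldType) (m : nat) : gegen R m 0 = 1.
Proof. by []. Qed.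

Lemma gegenS (R : realFieldType) (m k : nat) :
  gegen R m k.+1 = (k.*2 + m.+1)%:R *: ('X * gegen R m k)
                   - gegen_coef R m k *: gegen R m k.-1.
Proof.
by case: k => [|k] //; rewrite /gegen/= /gegen_coef mul0n !scale0r.
Qed.

Lemma mulX_gegen (R : realFieldType) (m k : nat) :
  (k.*2 + m.+1)%:R *: ('X * gegen R m k) =
  gegen R m k.+1 + gegen_coef R m k *: gegen R m k.-1.
Proof. by rewrite gegenS subrK. Qed.

Lemma gegen_deriv (R : realFieldType) (m k : nat) :
  (1 - 'X ^+ 2) * (gegen R m k)^`() =
  - k%:R *: ('X * gegen R m k) + gegen_coef R m k *: gegen R m k.-1.
Proof.
suff [] : (1 - 'X ^+ 2) * (gegen R m k)^`() =
  - k%:R *: ('X * gegen R m k) + gegen_coef R m k *: gegen R m k.-1 /\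
  (1 - 'X ^+ 2) * (gegen R m k.+1)^`() =
  - k.+1%:R *: ('X * gegen R m k.+1) + gegen_coef R m k.+1 *: gegen R m k by [].
elim: k => [|k [IH0 IH1]].
  rewrite gegenS gegen0 /gegen_coef /= mul0n !scale0r subr0 mulr1 derivC derivZ derivX.
  split; first by rewrite mulr0 oppr0 scale0r addr0.
  rewrite mul1n add0n -!mul_polyC !polyCN !polyC1 !polyC_natr; ring.
split=> //.
rewrite [gegen R m k.+2]gegenS /= derivB !derivZ derivM derivX mul1r.
have -> : (1 - 'X ^+ 2) * ((k.+1.*2 + m.+1)%:R *:
    (gegen R m k.+1 + 'X * (gegen R m k.+1)^`())
  - gegen_coef R m k.+1 *: (gegen R m k)^`()) =
  (k.+1.*2 + m.+1)%:R *: ((1 - 'X ^+ 2) * gegen R m k.+1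
     + 'X * ((1 - 'X ^+ 2) * (gegen R m k.+1)^`()))
  - gegen_coef R m k.+1 *: ((1 - 'X ^+ 2) * (gegen R m k)^`()).
  by rewrite -!mul_polyC; ring.
rewrite IH0 IH1.
have -> : gegen_coef R m k *: gegen R m k.-1 =
   (k.*2 + m.+1)%:R *: ('X * gegen R m k) - gegen R m k.+1.
  by rewrite gegenS; ring.
rewrite /gegen_coef -!mul_polyC !polyCN !polyC_natr -!addnn.
by ring.
Qed.

(** A zonal harmonic of positive degree has average 0.  Applying
[sphmean_divergence] to the polynomial itself and eliminating its product by
[X] with the recurrence relates the averages in degrees [k + 1] and
[k - 1]; the factor [k - 1] stops the descent from even degrees before it
reaches degree 0. *)
Lemma sphmean_gegen (R : realFieldType) (m k : nat) :
  sphmean m (gegen R m k.+1) = 0.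
Proof.
suff [] : sphmean m (gegen R m k.+1) = 0 /\ sphmean m (gegen R m k.+2) = 0 by [].
have rec j : (j + m.+2)%:R * sphmean m (gegen R m j.+1) =
    (j%:R - 1) * gegen_coef R m j * sphmean m (gegen R m j.-1).
  have := sphmean_divergence m (gegen R m j); rewrite gegen_deriv.
  have -> : - j%:R *: ('X * gegen R m j) + gegen_coef R m j *: gegen R m j.-1 -
      m.+2%:R *: ('X * gegen R m j) =
    - (j + m.+2)%:R *: ('X * gegen R m j) + gegen_coef R m j *: gegen R m j.-1.
    by rewrite -!mul_polyC !polyCN !polyC_natr; ring.
  move/(congr1 (fun x => (j.*2 + m.+1)%:R * x)); rewrite mulr0.
  rewrite linearD/= mulrDr -sphmeanZ scalerA mulrC -scalerA.
  rewrite mulX_gegen sphmeanZ linearD/= !sphmeanZ.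
  rewrite -addnn => /(congr1 -%R); rewrite oppr0 => H.
  by apply/eqP; rewrite -subr_eq0 -H; apply/eqP; ring.
have nz j : (j + m.+2)%:R != 0 :> R by rewrite pnatr_eq0; lia.
elim: k => [|k [IH0 IH1]]; split=> //.
- by apply: (mulfI (nz 0)); rewrite mulr0 rec /gegen_coef mul0n mulr0 mul0r.
- by apply: (mulfI (nz 1)); rewrite mulr0 rec subrr !mul0r.
- by apply: (mulfI (nz k.+2)); rewrite mulr0 rec IH0 mulr0.
Qed.

(** * Bernstein polynomials and their averages *)

Definition bernstein (A : comNzRingType) (x y : A) (N k : nat) : A :=
  x ^+ k * y ^+ (N - k) *+ 'C(N, k).

Lemma sum_bernstein (A : comNzRingType) (x y : A) (N : nat) : x + y = 1 ->
  \sum_(k < N.+1) bernstein x y N k = 1.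
Proof.
move=> xy1; rewrite -[1](expr1n A N) -xy1 addrC exprDn.
by apply: eq_bigr => k _; rewrite /bernstein mulrC.
Qed.

Lemma bernstein_shift (A : comNzRingType) (x y : A) (N k : nat) :
  k.+1%:R * bernstein x y N.+1 k.+1 = N.+1%:R * x * bernstein x y N k.
Proof.
have binE : k.+1%:R * 'C(N.+1, k.+1)%:R = N.+1%:R * 'C(N, k)%:R :> A.
  by rewrite -!natrM -mul_bin_diag.
rewrite /bernstein subSS exprS -[_ *+ 'C(N.+1, _)]mulr_natl.
rewrite -[_ *+ 'C(N, _)]mulr_natl mulrA binE; ring.
Qed.

Lemma sum_bernstein1 (A : comNzRingType) (x y : A) (N : nat) : x + y = 1 ->
  \sum_(k < N.+1) k%:R * bernstein x y N k = N%:R * x.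
Proof.
move=> xy1; case: N => [|N]; first by rewrite big_ord1 !mul0r.
rewrite big_ord_recl mul0r add0r.
under eq_bigr => k _ do rewrite bernstein_shift.
by rewrite -mulr_sumr sum_bernstein// mulr1.
Qed.

Lemma sum_bernstein2 (A : comNzRingType) (x y : A) (N : nat) : x + y = 1 ->
  \sum_(k < N.+1) (k%:R * (k%:R - 1)) * bernstein x y N k
    = N%:R * (N%:R - 1) * x ^+ 2.
Proof.
move=> xy1; case: N => [|N]; first by rewrite big_ord1 !mul0r.
rewrite big_ord_recl !mul0r add0r.
under eq_bigr => k _ do rewrite lift0 -[in _ - 1]natr1 addrK [_ * k%:R]mulrC
  -mulrA bernstein_shift mulrCA.
rewrite -mulr_sumr sum_bernstein1//; ring.
Qed.

Definition up_poly (R : realFieldType) : {poly R} := 2^-1 *: (1 + 'X).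
Definition down_poly (R : realFieldType) : {poly R} := 2^-1 *: (1 - 'X).

Lemma up_down_poly (R : realFieldType) : up_poly R + down_poly R = 1.
Proof.
rewrite /up_poly /down_poly -scalerDr.
have -> : 1 + 'X + (1 - 'X) = 2%:P :> {poly R} by rewrite polyC_natr; ring.
by rewrite -mul_polyC -polyCM mulVf ?pnatr_eq0.
Qed.

(** [sphmean_divergence] for [x^a y^b], with [x = (1 + X) / 2] and
[y = (1 - X) / 2]: since [1 - X^2 = 4 x y], only two monomials in [x] and [y]
survive. *)
Lemma sphmean_beta_step (R : realFieldType) (m a b : nat) :
  (a.*2 + m.+2)%:R * sphmean m (up_poly R ^+ a * down_poly R ^+ b.+1) =
  (b.*2 + m.+2)%:R * sphmean m (up_poly R ^+ a.+1 * down_poly R ^+ b).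
Proof.
set x := up_poly R; set y := down_poly R.
have dx : x^`() = 2^-1%:P.
  by rewrite /x derivZ derivD derivC derivX add0r alg_polyC.
have dy : y^`() = - 2^-1%:P.
  by rewrite /y derivZ derivB derivC derivX add0r scalerN alg_polyC.
have X1 : 1 - 'X ^+ 2 = 4%:R%:P * x * y.
  rewrite /x /y /up_poly /down_poly -!mul_polyC.
  by transitivity ((2 * 2^-1%:P) ^+ 2 * (1 - 'X ^+ 2) : {poly R});
    [rewrite -polyC_natr -polyCM mulfV ?pnatr_eq0// polyC1; ring
    |rewrite -polyC_natr; ring].
have half : 2 * 2^-1%:P = 1 :> {poly R}.
  by rewrite -polyC_natr -polyCM mulfV ?pnatr_eq0.
have XE : 'X = x - y.
  transitivity ((2 * 2^-1%:P) * 'X : {poly R}); first by rewrite half mul1r.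
  by rewrite /x /y /up_poly /down_poly -!mul_polyC; ring.
have E : (1 - 'X ^+ 2) * (x ^+ a * y ^+ b)^`()
    - m.+2%:R *: ('X * (x ^+ a * y ^+ b)) =
  (a.*2 + m.+2)%:R *: (x ^+ a * y ^+ b.+1)
    - (b.*2 + m.+2)%:R *: (x ^+ a.+1 * y ^+ b).
  have da : x * (x ^+ a)^`() = a%:R * 2^-1%:P * x ^+ a.
    rewrite deriv_exp dx; case: (a) => [|k]; first by rewrite !mulr0n; ring.
    by rewrite -[_ *+ _]mulr_natl exprS; ring.
  have db : y * (y ^+ b)^`() = - (b%:R * 2^-1%:P * y ^+ b).
    rewrite deriv_exp dy; case: (b) => [|k]; first by rewrite !mulr0n; ring.
    by rewrite -[_ *+ _]mulr_natl exprS; ring.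
  rewrite X1 derivM XE -!mul_polyC !polyC_natr -!addnn.
  transitivity (4 * (y ^+ b * y) * (x * (x ^+ a)^`())
    + 4 * (x ^+ a * x) * (y * (y ^+ b)^`())
    - m.+2%:R * ((x - y) * (x ^+ a * y ^+ b))); first by ring.
  rewrite da db.
  transitivity (a.*2%:R * (2 * 2^-1%:P) * x ^+ a * y ^+ b.+1
    - b.*2%:R * (2 * 2^-1%:P) * x ^+ a.+1 * y ^+ b
    - m.+2%:R * ((x - y) * (x ^+ a * y ^+ b))).
    by rewrite -!addnn !exprS; ring.
  by rewrite half -!addnn !exprS; ring.
have := sphmean_divergence m (x ^+ a * y ^+ b).
by rewrite E sphmeanB !sphmeanZ => /eqP; rewrite subr_eq0 => /eqP.
Qed.

(** Up to a power of 2 this is a rising factorial of [(m + 2) / 2], the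
parameter of the Beta law followed by [(1 + s) / 2]. *)
Definition rising (R : realFieldType) (m a : nat) : R :=
  \prod_(i < a) (i.*2 + m.+2)%:R.

Lemma rising_gt0 (R : realFieldType) (m a : nat) : 0 < rising R m a.
Proof. by apply: prodr_gt0 => i _; rewrite ltr0n addnS. Qed.

Lemma sphmean_beta (R : realFieldType) (m a b : nat) :
  sphmean m (up_poly R ^+ a * down_poly R ^+ b) * rising R m (a + b) =
  sphmean m (down_poly R ^+ (a + b)) * (rising R m a * rising R m b).
Proof.
elim: a b => [|a IH] b.
  by rewrite expr0 mul1r add0n [rising _ _ 0]big_ord0 mul1r.
have nz : (b.*2 + m.+2)%:R != 0 :> R by rewrite pnatr_eq0 addnS.
apply: (mulfI nz); rewrite [LHS]mulrA -sphmean_beta_step -mulrA.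
have := IH b.+1; rewrite addnS addSn => ->.
by rewrite /rising !big_ord_recr/=; ring.
Qed.

(** The weight that the average of a Bernstein polynomial gives to its node of
index [k]; these are the weights of a Beta-binomial law. *)
Definition bern_weight (R : realFieldType) (m N k : nat) : R :=
  sphmean m (bernstein (up_poly R) (down_poly R) N k).

Lemma sum_bern_weight (R : realFieldType) (m N : nat) (a : nat -> R) :
  sphmean m (\sum_(k < N.+1) a k *: bernstein (up_poly R) (down_poly R) N k)
  = \sum_(k < N.+1) bern_weight R m N k * a k.
Proof.
by rewrite linear_sum; apply: eq_bigr => k _; rewrite /= sphmeanZ mulrC.
Qed.

Lemma sum_bern_weight1 (R : realFieldType) (m N : nat) :
  \sum_(k < N.+1) bern_weight R m N k = 1.
Proof.
rewrite -(sphmean1 R m) -(sum_bernstein N (up_down_poly R)) linear_sum.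
by [].
Qed.

Lemma bern_weightE (R : realFieldType) (m N k : nat) : (k <= N)%N ->
  bern_weight R m N k = sphmean m (down_poly R ^+ N) / rising R m N *
    ('C(N, k)%:R * (rising R m k * rising R m (N - k))).
Proof.
move=> le_kN; have := sphmean_beta R m k (N - k); rewrite subnKC//.
have /lt0r_neq0 nz := rising_gt0 R m N.
rewrite /bern_weight /bernstein -[_ *+ _]scaler_nat sphmeanZ.
move=> /(canRL (mulfK nz)) ->.
by rewrite -!mulrA; ring.
Qed.

(** The weights add up to 1 and are this number times positive ones. *)
Lemma sphmean_down_gt0 (R : realFieldType) (m N : nat) :
  0 < sphmean m (down_poly R ^+ N).
Proof.
have := sum_bern_weight1 R m N.
under eq_bigr => k _ do rewrite bern_weightE -1?ltnS ?ltn_ord//.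
rewrite -mulr_sumr; set S := (\sum_(k < _) _) => eq1.
have S_gt0 : 0 < S.
  rewrite /S big_ord_recl ltr_pwDl//.
    by rewrite bin0 mul1r mulr_gt0 ?rising_gt0.
  by apply: sumr_ge0 => i _; rewrite !mulr_ge0 ?ler0n// ltW// rising_gt0.
have := @ltr01 R; rewrite -eq1 pmulr_lgt0// pmulr_lgt0 ?invr_gt0//.
exact: rising_gt0.
Qed.

Lemma bern_weight_ge0 (R : realFieldType) (m N k : nat) : (k <= N)%N ->
  0 <= bern_weight R m N k.
Proof.
move=> le_kN; rewrite bern_weightE// !mulr_ge0 ?invr_ge0 ?ler0n ?ltW//.
all: by rewrite ?rising_gt0 ?sphmean_down_gt0.
Qed.

Lemma bern_weight_sym (R : realFieldType) (m N k : nat) : (k <= N)%N ->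
  bern_weight R m N (N - k) = bern_weight R m N k.
Proof.
move=> le_kN; rewrite !bern_weightE ?leq_subr// bin_sub// subKn//.
by rewrite [rising _ _ (N - k) * _]mulrC.
Qed.

(** The weights increase up to the middle index.  The ratio of consecutive
weights is explicit, and comparing it with 1 comes down to
[m k <= m (N - k - 1)]: this is where the dimension is at least 3. *)
Lemma bern_weight_le (R : realFieldType) (m N k : nat) : (k.*2 < N)%N ->
  bern_weight R m N k <= bern_weight R m N k.+1.
Proof.
move=> lt_kN; have le_k1N : (k.+1 <= N)%N by lia.
have rec : bern_weight R m N k.+1 * (k.+1 * ((N - k.+1).*2 + m.+2))%:R
         = bern_weight R m N k * ((N - k) * (k.*2 + m.+2))%:R.
  rewrite !bern_weightE ?(ltnW le_k1N)//.
  have -> : rising R m k.+1 = rising R m k * (k.*2 + m.+2)%:R.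
    by rewrite /rising big_ord_recr.
  have -> : rising R m (N - k) =
      rising R m (N - k.+1) * ((N - k.+1).*2 + m.+2)%:R.
    by rewrite -(subnSK le_k1N) /rising big_ord_recr.
  have := congr1 (fun i => i%:R : R) (mul_bin_left N k); rewrite !natrM => binE.
  set c := sphmean _ _ / _.
  transitivity (c * (k.+1%:R * 'C(N, k.+1)%:R) * (rising R m k *
    (k.*2 + m.+2)%:R * rising R m (N - k.+1)) * ((N - k.+1).*2 + m.+2)%:R).
    by ring.
  by rewrite binE; ring.
have pos : 0 < (k.+1 * ((N - k.+1).*2 + m.+2))%:R :> R by rewrite ltr0n muln_gt0 addnS.
rewrite -(ler_pM2r pos) rec ler_wpM2l ?bern_weight_ge0 ?(ltnW le_k1N)//.
rewrite ler_nat; clear pos rec; have [d ed] : {d | N = (k.+1 + d)%N}.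
  by exists (N - k.+1)%N; rewrite subnKC.
have le_kd : (k <= d)%N by lia.
have := leq_mul (leqnn m) le_kd.
have -> : (N - k.+1 = d)%N by lia.
have -> : (N - k = d.+1)%N by lia.
by rewrite -!addnn; nia.
Qed.

(** A symmetric unimodal weight is a combination with nonnegative coefficients
of indicators of centred intervals, so it is enough to test [psi] on these.
The induction peels off the two extreme terms of an interval. *)
Lemma sum_unimodal_ge0 (R : realDomainType) (N : nat) (w psi : nat -> R) :
    (forall k, (k <= N)%N -> 0 <= w k) ->
    (forall k, (k <= N)%N -> w (N - k)%N = w k) ->
    (forall k, (k.*2 < N)%N -> w k <= w k.+1) ->
    (forall j, (j.*2 <= N)%N -> 0 <= \sum_(j <= k < (N - j).+1) psi k) ->
  0 <= \sum_(k < N.+1) w k * psi k.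
Proof.
move=> w_ge0 w_sym w_le psi_ge0.
have key d : forall j, N = (j.*2 + d)%N ->
    w j * \sum_(j <= k < (N - j).+1) psi k
    <= \sum_(j <= k < (N - j).+1) w k * psi k.
  elim/ltn_ind: d => -[_ j eN|[_ j eN|d IH j eN]].
  - have -> : (N - j = j)%N by lia.
    by rewrite !big_nat1.
  - have eNj : (N - j = j.+1)%N by lia.
    have le_jN : (j <= N)%N by lia.
    have := w_sym j le_jN; rewrite eNj => ew.
    by rewrite !(big_nat_recr j.+1)//= !big_nat1 ew mulrDr.
  - have eNj : (N - j = (N - j.+1).+1)%N by lia.
    have le_jN : (j <= N)%N by lia.
    have lt_j : (j <= (N - j.+1).+1)%N by lia.
    have lt_j' : (j < (N - j.+1).+1)%N by lia.
    have ew : w (N - j.+1).+1 = w j by rewrite -eNj w_sym.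
    rewrite eNj !(big_nat_recr (N - j.+1).+1)//= ew mulrDr lerD2r.
    rewrite !(big_ltn lt_j') mulrDr lerD2l.
    apply: le_trans (IH d _ j.+1 _); [|lia..].
    by rewrite ler_wpM2r ?w_le ?psi_ge0//; lia.
have := key N 0 (esym (add0n _)); rewrite subn0 -(big_mkord xpredT (fun k => w k * psi k)) => le1.
apply: le_trans le1; rewrite mulr_ge0 ?w_ge0//.
by have := psi_ge0 0; rewrite subn0; apply.
Qed.

(** An antiderivative of the absolute value. *)
Definition half_sq (R : realFieldType) (z : R) : R := z * `|z| / 2.

(** The midpoint rule underestimates the integral of a convex function. *)
Lemma normr_midpoint (R : realFieldType) (z d : R) : 0 <= d ->
  `|z| * (2 * d) <= half_sq (z + d) - half_sq (z - d).
Proof.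
move=> d0; rewrite /half_sq.
case: (ger0P z) => z0; case: (ger0P (z + d)) => zp; case: (ger0P (z - d)) => zm;
  by nra.
Qed.

Definition node (R : realFieldType) (N k : nat) : R := k%:R * 2 / N%:R - 1.

(** The average of [|x - t|] over [[-b, b]] is at most [(1 + t^2) / 2] when
[b <= 1], and the difference is at least [(1 - |t|)^2 / 4] times [1 - b^2].
The step [h] of the nodes pays for the discretization, where [b] can exceed
1 slightly. *)
Lemma half_sq_gap (R : realFieldType) (t b h : R) :
    -1 < t < 1 -> 0 < b -> b <= 1 + h -> 0 <= h <= 1 ->
  half_sq (b - t) + half_sq (b + t) <=
  2 * b * ((1 + t ^+ 2) / 2 + h - (1 - `|t|) ^+ 2 / 4 * (1 - b ^+ 2 + h ^+ 2)).
Proof.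
wlog t0 : t / 0 <= t => [hw|].
  case: (lerP 0 t) => t0; first exact: hw.
  move=> t1 b0 bh h0; have := hw (- t).
  rewrite normrN sqrrN opprK [half_sq (b + t) + _]addrC.
  by apply=> //; lra.
move=> t1 b0 bh h01; rewrite (ger0_norm t0).
set c := (1 - t) ^+ 2 / 4.
have c0 : 0 <= c by rewrite /c mulr_ge0 ?sqr_ge0 ?invr_ge0.
have c4 : 4 * c = (1 - t) ^+ 2 by rewrite /c; field.
have c1 : 4 * c <= 1 - t by rewrite c4; nra.
have c2 : c <= 4^-1 by lra.
have E : h / 2 <= h - c * h ^+ 2 by nra.
have {E}E : b * h <= 2 * b * (h - c * h ^+ 2).
  have -> : b * h = 2 * b * (h / 2) by field.
  by rewrite ler_wpM2l// mulr_ge0// ltW.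
suff : half_sq (b - t) + half_sq (b + t) <=
   b * (1 + t ^+ 2) + b * h - 2 * b * c * (1 - b ^+ 2).
  move/le_trans; apply.
  rewrite -subr_ge0 (_ : _ - _ = 2 * b * (h - c * h ^+ 2) - b * h) ?subr_ge0//.
  by field.
have -> : half_sq (b + t) = (b + t) ^+ 2 / 2.
  by rewrite /half_sq ger0_norm ?expr2//; lra.
case: (lerP t b) => tb.
  have -> : half_sq (b - t) = (b - t) ^+ 2 / 2.
    by rewrite /half_sq ger0_norm ?expr2//; lra.
  rewrite -subr_ge0.
  have -> : b * (1 + t ^+ 2) + b * h - 2 * b * c * (1 - b ^+ 2)
      - ((b - t) ^+ 2 / 2 + (b + t) ^+ 2 / 2) =
      (1 - b) * ((b - t ^+ 2) - 2 * b * c * (1 + b)) + b * h by field.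
  case: (lerP b 1) => b1.
    apply: addr_ge0; last by apply: mulr_ge0; lra.
    apply: mulr_ge0; first lra.
    have : b * (2 * c * (1 + b)) <= b * (1 - t) by rewrite ler_wpM2l //; nra.
    nra.
  have : 0 <= (b - 1) * (b * c * (1 + b)).
    by rewrite !mulr_ge0 //; lra.
  nra.
have -> : half_sq (b - t) = - ((b - t) ^+ 2 / 2).
  by rewrite /half_sq ltr0_norm ?expr2; [field|lra].
have : b * (4 * c) = b * (1 - t) ^+ 2 by rewrite c4.
have bc0 : 0 <= b * c by rewrite mulr_ge0// ltW.
have : 0 <= (b * c) * b ^+ 2 by rewrite mulr_ge0 ?sqr_ge0.
have : 0 <= b * h by rewrite mulr_ge0//; lra.
nra.
Qed.

(** Both sides are averages over the nodes, so that [sum_unimodal_ge0] reduces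
the inequality to equal weights on centred sets of nodes.  There the sums are
compared with integrals by a telescoping antiderivative. *)
Lemma sum_bern_weight_norm (R : realFieldType) (m N : nat) (t : R) :
    (0 < N)%N -> -1 < t < 1 ->
  \sum_(k < N.+1) bern_weight R m N k * `|node R N k - t| <=
  (1 + t ^+ 2) / 2 + N%:R^-1 - (1 - `|t|) ^+ 2 / 4 *
    (1 - 3 * \sum_(k < N.+1) bern_weight R m N k * node R N k ^+ 2).
Proof.
move=> N0 t1; set c := (1 - `|t|) ^+ 2 / 4; set h := N%:R^-1.
have Nh : N%:R * h = 1 by rewrite /h mulfV// pnatr_eq0 -lt0n.
have h0 : 0 < h by rewrite invr_gt0 ltr0n.
have h1 : h <= 1 by rewrite /h invf_le1 ?ltr0n// ler1n.
set B := (1 + t ^+ 2) / 2 + h - c.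
pose psi k := B - `|node R N k - t| + 3 * c * node R N k ^+ 2.
suff psi_sum : 0 <= \sum_(k < N.+1) bern_weight R m N k * psi k.
  rewrite -subr_ge0; apply: le_trans psi_sum _.
  rewrite le_eqVlt; apply/orP; left; apply/eqP.
  under eq_bigr => k _ do rewrite /psi mulrDr mulrBr mulrCA.
  rewrite big_split/= sumrB -mulr_suml -mulr_sumr sum_bern_weight1 /B.
  by ring.
apply: sum_unimodal_ge0.
- exact: bern_weight_ge0.
- exact: bern_weight_sym.
- exact: bern_weight_le.
move=> j jN.
(* [y k] is the midpoint of the nodes [k - 1] and [k], and [T] is an
   antiderivative of [psi] as a function of the node; the cubic term is not
   integrated exactly by the midpoint rule, hence the correction [c h^2] *)
pose y k := (k.*2%:R - 1) * h - 1 : R.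
pose T z := (B - c * h ^+ 2) * z - half_sq (z - t) + c * z ^+ 3.
have step k : T (y k.+1) - T (y k) <= psi k * (2 * h).
  have -> : y k.+1 = node R N k + h.
    by rewrite /y /node -/h -!addnn; ring.
  have -> : y k = node R N k - h.
    by rewrite /y /node -/h -!addnn; ring.
  have := normr_midpoint (node R N k - t) (ltW h0).
  rewrite /T /psi; set x := node R N k.
  rewrite [x - t + h]addrAC [x - t - h]addrAC.
  by move=> H; nra.
rewrite -(pmulr_lge0 _ (_ : 0 < 2 * h)); last by rewrite mulr_gt0.
rewrite mulr_suml; apply: le_trans (ler_sum_nat (fun k _ => step k)).
rewrite telescope_sumr; last by lia.
set b := (N - j).+1%:R * 2 * h - 1 - h.
have -> : y (N - j).+1 = b by rewrite /y /b -addnn; ring.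
have -> : y j = - b.
  rewrite /y /b -addnn -natr1 natrB; last by lia.
  by transitivity (2 * j%:R * h - h - 2 * (N%:R * h) + 1);
    [rewrite Nh; ring|ring: Nh].
have b0 : 0 < b.
  have -> : b = (N.+1 - j.*2)%:R * h.
    rewrite /b -natr1 !natrB; [|lia..].
    by rewrite -addnn -!natr1; ring: Nh.
  by rewrite mulr_gt0// ltr0n; lia.
have bh : b <= 1 + h.
  have -> : b = 1 + h - j.*2%:R * h.
    by rewrite /b -natr1 natrB -?addnn; [ring: Nh|lia].
  by rewrite lerBlDr lerDl mulr_ge0// ltW.
have := half_sq_gap t1 b0 bh; rewrite ltW// h1 => /(_ isT).
rewrite -/c /T => H.
have -> : half_sq (- b - t) = - half_sq (b + t).
  by rewrite /half_sq -opprD normrN mulNr mulNr.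
rewrite /B; nra.
Qed.

Lemma sum_bern_weight_sq (R : realFieldType) (m N : nat) : (0 < N)%N ->
  \sum_(k < N.+1) bern_weight R m N k * node R N k ^+ 2 <=
  m.+3%:R^-1 + N%:R^-1.
Proof.
move=> N0; set h := N%:R^-1.
have Nh : N%:R * h = 1 by rewrite /h mulfV// pnatr_eq0 -lt0n.
have h0 : 0 < h by rewrite invr_gt0 ltr0n.
rewrite -(sum_bern_weight m N (fun k => node R N k ^+ 2)).
set x := up_poly R; set y := down_poly R.
have xy1 : x + y = 1 := up_down_poly R.
have half : 2 * 2^-1%:P = 1 :> {poly R}.
  by rewrite -polyC_natr -polyCM mulfV ?pnatr_eq0.
have XE : 'X = x - y.
  transitivity ((2 * 2^-1%:P) * 'X : {poly R}); first by rewrite half mul1r.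
  by rewrite /x /y /up_poly /down_poly -!mul_polyC; ring.
have -> : \sum_(k < N.+1) node R N k ^+ 2 *: bernstein x y N k =
    h *: 1 + (1 - h) *: 'X^2.
  transitivity ((4 * h ^+ 2)%:P *
      \sum_(k < N.+1) (k%:R * (k%:R - 1)) * bernstein x y N k +
      (4 * h ^+ 2 - 4 * h)%:P * \sum_(k < N.+1) k%:R * bernstein x y N k +
      \sum_(k < N.+1) bernstein x y N k).
    rewrite !mulr_sumr -!big_split/=; apply: eq_bigr => k _.
    rewrite /node -/h -mul_polyC.
    by rewrite !(polyCD, polyCN, polyCM, polyC_exp, polyC_natr, polyC1); ring.
  rewrite sum_bernstein2// sum_bernstein1// sum_bernstein//.
  have NhP : N%:R * h%:P = 1 :> {poly R} by rewrite -polyC_natr -polyCM Nh.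
  rewrite -!mul_polyC !(polyCD, polyCN, polyCM, polyC_exp, polyC_natr, polyC1) XE.
  transitivity (4 * ((N%:R * h%:P) * (N%:R * h%:P) - (N%:R * h%:P) * h%:P) * x ^+ 2 +
     (4 * h%:P * (N%:R * h%:P) - 4 * (N%:R * h%:P)) * x + 1); first by ring.
  have -> : y = 1 - x by rewrite -xy1; ring.
  by rewrite NhP; ring.
rewrite linearD/= !sphmeanZ sphmean1 sphmeanXn/= mulr1 add0n.
rewrite !mulr1 div1r mulrBl mul1r addrC lerD2r gerBl.
by rewrite mulr_ge0 ?invr_ge0// ltW.
Qed.

(** The Bernstein polynomial of [|s - t|] is above it because its value at [s]
is an average of [|x - t|] over nodes [x] of mean [s].  The variance [1/n] of
the coordinate, against 1/3 for a uniform law, produces the gain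
[m / (m + 3) = 1 - 3 / n]. *)
Lemma exists_majorant (R : realFieldType) (m N : nat) (t : R) :
    (0 < N)%N -> -1 < t < 1 ->
  exists p : {poly R}, (forall s, -1 <= s <= 1 -> `|s - t| <= p.[s]) /\
    sphmean m p <= (1 + t ^+ 2) / 2 - (1 - `|t|) ^+ 2 / 4 * (m%:R / m.+3%:R)
                   + 2 / N%:R.
Proof.
move=> N0 t1.
exists (\sum_(k < N.+1) `|node R N k - t| *:
         bernstein (up_poly R) (down_poly R) N k); split.
  move=> s s1; rewrite horner_sum.
  set X := (1 + s) / 2; set Y := (1 - s) / 2.
  have XY1 : X + Y = 1 by rewrite /X /Y; field.
  have hX : (up_poly R).[s] = X.
    by rewrite /up_poly !hornerE /X mulrC.
  have hY : (down_poly R).[s] = Y.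
    by rewrite /down_poly !hornerE /Y mulrC.
  have hb k : (bernstein (up_poly R) (down_poly R) N k).[s] = bernstein X Y N k.
    by rewrite /bernstein hornerMn hornerM !horner_exp hX hY.
  have b0 k : 0 <= bernstein X Y N k.
    by rewrite /bernstein mulrn_wge0// mulr_ge0// exprn_ge0// /X /Y; lra.
  have -> : s - t = \sum_(k < N.+1) (node R N k - t) * bernstein X Y N k.
    transitivity (2 / N%:R * (\sum_(k < N.+1) k%:R * bernstein X Y N k)
        - (1 + t) * (\sum_(k < N.+1) bernstein X Y N k)).
      by rewrite sum_bernstein1// sum_bernstein// /X; field; rewrite pnatr_eq0 -lt0n.
    by rewrite !mulr_sumr -sumrB; apply: eq_bigr => k _; rewrite /node; ring.
  apply: le_trans (ler_norm_sum _ _ _) _.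
  by apply: ler_sum => k _; rewrite hornerZ hb normrM (ger0_norm (b0 k)).
rewrite (sum_bern_weight m N (fun k => `|node R N k - t|)).
apply: le_trans (sum_bern_weight_norm m N0 t1) _.
have := sum_bern_weight_sq R m N0; set S := (\sum_(k < _) _) => leS.
have -> : m%:R / m.+3%:R = 1 - 3 / m.+3%:R :> R.
  by rewrite -!natr1; field; rewrite !natr1 pnatr_eq0.
set c := _ / 4; have c0 : 0 <= c by rewrite divr_ge0 ?sqr_ge0.
have c1 : c <= 4^-1.
  have at1 : `|t| <= 1 by rewrite ler_norml; lra.
  by rewrite /c ler_piMl ?invr_ge0// exprn_ile1 ?subr_ge0 ?gerBl.
have : c * S <= c * (m.+3%:R^-1 + N%:R^-1) by rewrite ler_wpM2l.
have : c * N%:R^-1 <= 4^-1 * N%:R^-1 by rewrite ler_wpM2r ?invr_ge0.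
have : 0 <= N%:R^-1 :> R by rewrite invr_ge0.
move: leS; move: (m.+3%:R^-1) (N%:R^-1) => K h; lra.
Qed.

(** * The Euclidean norm *)

Definition sqnorm (R : realType) (n : nat) (x : 'rV[R]_n) : R :=
  \sum_(i < n) x ord0 i ^+ 2.

Definition dot (R : realType) (n : nat) (x y : 'rV[R]_n) : R :=
  \sum_(i < n) x ord0 i * y ord0 i.

Lemma sqnorm_ge0 (R : realType) (n : nat) (x : 'rV[R]_n) : 0 <= sqnorm x.
Proof. by apply: sumr_ge0 => i _; apply: sqr_ge0. Qed.

Lemma enormE (R : realType) (n : nat) (x : 'rV[R]_n) :
  enorm x = Num.sqrt (sqnorm x).
Proof. by []. Qed.

Lemma enorm_ge0 (R : realType) (n : nat) (x : 'rV[R]_n) : 0 <= enorm x.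
Proof. exact: sqrtr_ge0. Qed.

Lemma enorm_sqr (R : realType) (n : nat) (x : 'rV[R]_n) :
  enorm x ^+ 2 = sqnorm x.
Proof. by rewrite sqr_sqrtr// sqnorm_ge0. Qed.

Lemma dotC (R : realType) (n : nat) (x y : 'rV[R]_n) : dot x y = dot y x.
Proof. by apply: eq_bigr => i _; rewrite mulrC. Qed.

Lemma sqnormD (R : realType) (n : nat) (x y : 'rV[R]_n) :
  sqnorm (x + y) = sqnorm x + 2 * dot x y + sqnorm y.
Proof.
rewrite /sqnorm /dot mulr_sumr -!big_split/=; apply: eq_bigr => i _.
by rewrite mxE; ring.
Qed.

Lemma sqnormZ (R : realType) (n : nat) (a : R) (x : 'rV[R]_n) :
  sqnorm (a *: x) = a ^+ 2 * sqnorm x.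
Proof. by rewrite /sqnorm mulr_sumr; apply: eq_bigr => i _; rewrite mxE exprMn. Qed.

Lemma dotZr (R : realType) (n : nat) (a : R) (x y : 'rV[R]_n) :
  dot x (a *: y) = a * dot x y.
Proof. by rewrite /dot mulr_sumr; apply: eq_bigr => i _; rewrite mxE mulrCA. Qed.

Lemma enormZ (R : realType) (n : nat) (a : R) (x : 'rV[R]_n) :
  enorm (a *: x) = `|a| * enorm x.
Proof. by rewrite !enormE sqnormZ sqrtrM ?sqr_ge0// sqrtr_sqr. Qed.

Lemma dotx0 (R : realType) (n : nat) (e : 'rV[R]_n) : dot e 0 = 0.
Proof. by apply: big1 => i _; rewrite mxE mulr0. Qed.

Lemma sqnorm0 (R : realType) (n : nat) : sqnorm (0 : 'rV[R]_n) = 0.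
Proof. by apply: big1 => i _; rewrite mxE expr0n. Qed.

(** The Cauchy-Schwarz inequality. *)
Lemma dot_le (R : realType) (n : nat) (x y : 'rV[R]_n) :
  dot x y <= enorm x * enorm y.
Proof.
have [x0|x0] := eqVneq (enorm x) 0.
  rewrite x0 mul0r le_eqVlt; apply/orP; left; apply/eqP.
  have : sqnorm x = 0 by rewrite -enorm_sqr x0 expr0n.
  move/eqP; rewrite psumr_eq0; last by move=> i _; apply: sqr_ge0.
  move=> /allP xi0; apply: big1 => i _.
  by have := xi0 i (mem_index_enum _); rewrite sqrf_eq0 => /eqP ->; rewrite mul0r.
have x_gt0 : 0 < enorm x by rewrite lt_def x0 enorm_ge0.
have [y0|y0] := ltrP (dot x y) 0.
  by apply: le_trans (ltW y0) _; rewrite mulr_ge0 ?enorm_ge0.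
rewrite -(@ler_pXn2r _ 2)// ?nnegrE ?mulr_ge0 ?enorm_ge0//.
rewrite exprMn !enorm_sqr.
have := sqnorm_ge0 (y + (- (dot x y / sqnorm x)) *: x).
have s_gt0 : 0 < sqnorm x by rewrite -enorm_sqr exprn_gt0.
rewrite sqnormD sqnormZ dotZr [dot y x]dotC.
have -> : sqnorm y + 2 * (- (dot x y / sqnorm x) * dot x y) +
   (- (dot x y / sqnorm x)) ^+ 2 * sqnorm x
   = (sqnorm x * sqnorm y - dot x y ^+ 2) / sqnorm x.
  by field; rewrite gt_eqF.
by rewrite pmulr_lge0 ?invr_gt0// subr_ge0.
Qed.

Lemma enormD (R : realType) (n : nat) (x y : 'rV[R]_n) :
  enorm (x + y) <= enorm x + enorm y.
Proof.
rewrite -(@ler_pXn2r _ 2)// ?nnegrE ?addr_ge0 ?enorm_ge0//.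
rewrite enorm_sqr sqnormD sqrrD !enorm_sqr lerD2r lerD2l mulr_natl.
by rewrite lerMn2r dot_le orbT.
Qed.

Lemma coord_le_enorm (R : realType) (n : nat) (x : 'rV[R]_n) (i : 'I_n) :
  `|x ord0 i| <= enorm x.
Proof.
rewrite -sqrtr_sqr ler_sqrt ?sqnorm_ge0// (bigD1 i)//= lerDl.
by apply: sumr_ge0 => j _; apply: sqr_ge0.
Qed.

Lemma continuous_sum (R : realType) (T : topologicalType) (I : Type)
    (r : seq I) (f : I -> T -> R) (x : T) :
  (forall i, {for x, continuous (f i)}) ->
  {for x, continuous (fun y => \sum_(i <- r) f i y)}.
Proof.
move=> fc; elim: r => [|i r IH].
  rewrite (_ : (fun _ => _) = cst 0); first exact: cst_continuous.
  by apply/funext => y; rewrite big_nil.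
rewrite (_ : (fun _ => _) = f i \+ (fun y => \sum_(i <- r) f i y)).
  by apply: continuousD.
by apply/funext => y; rewrite big_cons.
Qed.

Lemma sqnorm_continuous (R : realType) (n : nat) :
  continuous (@sqnorm R n).
Proof.
move=> x; apply: continuous_sum => i.
rewrite (_ : (fun _ => _) = (fun y : 'rV[R]_n => y ord0 i * y ord0 i)).
  by apply: continuousM; exact: coord_continuous.
by apply/funext => y; rewrite expr2.
Qed.

Lemma enorm_continuous (R : realType) (n : nat) : continuous (@enorm R n).
Proof.
move=> x; apply: (@continuous_comp _ _ _ (@sqnorm R n) Num.sqrt).
  exact: sqnorm_continuous.
exact: sqrt_continuous.
Qed.

Lemma closed_ball_compact (R : realType) (n : nat) :
  compact [set x : 'rV[R]_n | enorm x <= 1].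
Proof.
apply: bounded_closed_compact.
  exists 1; split=> // M M1 x /= x1.
  apply: le_trans (ltW M1).
  rewrite [leLHS]/Num.norm/= mx_normrE; apply/bigmax_leP; split=> //= -[i j] _.
  by rewrite /= ord1; apply: le_trans (coord_le_enorm _ _) x1.
apply: (@preimage_closed _ _ (@enorm R n) [set r | r <= 1]) => [y _|].
  exact: enorm_continuous.
exact: closed_le.
Qed.

Lemma open_ball_open (R : realType) (n : nat) (r : R) :
  open [set x : 'rV[R]_n | enorm x < r].
Proof.
apply: (@open_comp _ _ (@enorm R n) [set y | y < r]) => [x _|].
  exact: enorm_continuous.
exact: open_lt.
Qed.

(** * Derivatives along lines and second-order jets *)

Lemma is_derive_line (R : realType) (n : nat) (f : 'rV[R]_n -> R)
    (x v : 'rV[R]_n) (t d : R) :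
  is_derive (x + t *: v) v f d <-> is_derive t 1 (fun s => f (x + s *: v)) d.
Proof.
have E : (fun h : R => h^-1 *: ((f \o shift (x + t *: v)) (h *: v) -
             f (x + t *: v))) =
  (fun h : R => h^-1 *: (((fun s => f (x + s *: v)) \o shift t) (h *: 1) -
             f (x + t *: v))).
  apply/funext => h /=; congr (_ *: (f _ - _)).
  by rewrite [h *: 1]mulr1 scalerDl addrCA.
split=> -[dv <-]; (split; [move: dv|]); rewrite /derivable /derive.
all: by rewrite E.
Qed.

Lemma is_derive_affine (R : realType) (n : nat) (f : 'rV[R]_n -> R)
    (a : R) (b x v : 'rV[R]_n) (d : R) :
  is_derive (b + a *: x) v f d ->
  is_derive x v (fun y => f (b + a *: y)) (a * d).
Proof.
move=> fd; rewrite -[x]addr0 -(scale0r v); apply/is_derive_line.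
have -> : (fun s => f (b + a *: (x + s *: v))) =
   (fun s => f (b + a *: x + s *: v)) \o (fun s => a * s).
  by apply/funext => s /=; rewrite scalerDr addrA scalerA.
rewrite mulrC.
apply: is_derive1_comp.
  rewrite mulr0; apply/is_derive_line.
  by rewrite scale0r addr0.
by rewrite -[X in is_derive _ _ _ X]mulr1; apply: is_deriveZ.
Qed.

Lemma is_derive_coord (R : realType) (n : nat) (x v : 'rV[R]_n) (i : 'I_n) :
  is_derive x v (fun y : 'rV[R]_n => y ord0 i) (v ord0 i).
Proof.
rewrite -[x]addr0 -(scale0r v); apply/is_derive_line.
rewrite (_ : (fun _ => _) = cst (x ord0 i) + (fun s => v ord0 i * s)); last first.
  by apply/funext => s; rewrite !mxE mulrC.
rewrite -[X in is_derive _ _ _ X]add0r; apply: is_deriveD.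
by rewrite -[X in is_derive _ _ _ X]mulr1; apply: is_deriveZ.
Qed.

(** [G i] and [K i] are the first and the pure second derivatives along the
[i]-th axis.  Keeping them explicit turns the Laplacian into the computable
sum of the [K i], and mixed derivatives never occur. *)
Definition has_jet (R : realType) (n : nat) (U : set 'rV[R]_n)
    (f : 'rV[R]_n -> R) (G K : 'I_n -> 'rV[R]_n -> R) : Prop :=
  forall x, U x -> {for x, continuous f} /\
    forall i : 'I_n, is_derive x (delta_mx ord0 i : 'rV[R]_n) f (G i x) /\
                     is_derive x (delta_mx ord0 i : 'rV[R]_n) (G i) (K i x).

Lemma has_jet_sub (R : realType) (n : nat) (U W : set 'rV[R]_n)
    (f : 'rV[R]_n -> R) (G K : 'I_n -> 'rV[R]_n -> R) :
  W `<=` U -> has_jet U f G K -> has_jet W f G K.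
Proof. by move=> WU fj x /WU; exact: fj. Qed.

Lemma has_jet_cst (R : realType) (n : nat) (U : set 'rV[R]_n) (a : R) :
  has_jet U (fun=> a) (fun _ _ => 0) (fun _ _ => 0).
Proof.
move=> x _; split; first exact: cst_continuous.
by move=> i; split; apply: is_derive_cst.
Qed.

Lemma has_jetD (R : realType) (n : nat) (U : set 'rV[R]_n)
    (f g : 'rV[R]_n -> R) (G K G' K' : 'I_n -> 'rV[R]_n -> R) :
  has_jet U f G K -> has_jet U g G' K' ->
  has_jet U (fun x => f x + g x) (fun i x => G i x + G' i x)
    (fun i x => K i x + K' i x).
Proof.
move=> fj gj x Ux; have [cf df] := fj x Ux; have [cg dg] := gj x Ux.
split=> [|i]; first exact: continuousD.
have [df1 df2] := df i; have [dg1 dg2] := dg i.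
by split; apply: is_deriveD.
Qed.

Lemma has_jetM (R : realType) (n : nat) (U : set 'rV[R]_n)
    (f g : 'rV[R]_n -> R) (G K G' K' : 'I_n -> 'rV[R]_n -> R) :
  has_jet U f G K -> has_jet U g G' K' ->
  has_jet U (fun x => f x * g x) (fun i x => f x * G' i x + g x * G i x)
    (fun i x => f x * K' i x + 2 * (G i x * G' i x) + g x * K i x).
Proof.
move=> fj gj x Ux; have [cf df] := fj x Ux; have [cg dg] := gj x Ux.
split=> [|i]; first exact: continuousM.
have [df1 df2] := df i; have [dg1 dg2] := dg i.
split; first exact: is_deriveM.
have -> : f x * K' i x + 2 * (G i x * G' i x) + g x * K i x =
  (f x *: K' i x + G' i x *: G i x) + (g x *: K i x + G i x *: G' i x).
  by rewrite /GRing.scale/=; ring.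
by apply: is_deriveD; apply: is_deriveM.
Qed.

Lemma has_jetZ (R : realType) (n : nat) (U : set 'rV[R]_n) (a : R)
    (f : 'rV[R]_n -> R) (G K : 'I_n -> 'rV[R]_n -> R) :
  has_jet U f G K ->
  has_jet U (fun x => a * f x) (fun i x => a * G i x) (fun i x => a * K i x).
Proof.
move=> fj x Ux; have [cf df] := fj x Ux.
split=> [|i]; first by apply: continuousM => //; exact: cst_continuous.
have [df1 df2] := df i.
by split; apply: is_deriveZ.
Qed.

Lemma has_jet_sum (R : realType) (n : nat) (U : set 'rV[R]_n) (I : Type)
    (r : seq I) (f : I -> 'rV[R]_n -> R) (G K : I -> 'I_n -> 'rV[R]_n -> R) :
  (forall j, has_jet U (f j) (G j) (K j)) ->
  has_jet U (fun x => \sum_(j <- r) f j x) (fun i x => \sum_(j <- r) G j i x)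
    (fun i x => \sum_(j <- r) K j i x).
Proof.
move=> fj; elim: r => [|j r IH].
  have := @has_jet_cst R n U 0; congr (has_jet U _ _ _).
  - by apply/funext => x; rewrite big_nil.
  - by apply/funext => i; apply/funext => x; rewrite big_nil.
  - by apply/funext => i; apply/funext => x; rewrite big_nil.
have := has_jetD (fj j) IH; congr (has_jet U _ _ _).
- by apply/funext => x; rewrite big_cons.
- by apply/funext => i; apply/funext => x; rewrite big_cons.
- by apply/funext => i; apply/funext => x; rewrite big_cons.
Qed.

Lemma has_jet_affine (R : realType) (n : nat) (U W : set 'rV[R]_n) (a : R)
    (b : 'rV[R]_n) (f : 'rV[R]_n -> R) (G K : 'I_n -> 'rV[R]_n -> R) :
  has_jet U f G K -> (forall x, W x -> U (b + a *: x)) ->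
  has_jet W (fun x => f (b + a *: x)) (fun i x => a * G i (b + a *: x))
    (fun i x => a * (a * K i (b + a *: x))).
Proof.
move=> fj WU x Wx; have [cf df] := fj _ (WU x Wx).
split=> [|i].
  have ac : {for x, continuous (fun y : 'rV[R]_n => b + a *: y)}.
    by apply: continuousD; [exact: cst_continuous|exact: scaler_continuous].
  exact: (continuous_comp ac cf).
have [df1 df2] := df i.
by split; [|apply: is_deriveZ]; apply: is_derive_affine.
Qed.

Lemma has_jet_coord (R : realType) (n : nat) (U : set 'rV[R]_n) (j : 'I_n) :
  has_jet U (fun x => x ord0 j) (fun i _ => (i == j)%:R) (fun _ _ => 0).
Proof.
move=> x _; split=> [|i]; first exact: coord_continuous.
split; last exact: is_derive_cst.
by have := is_derive_coord x (delta_mx ord0 i) j; rewrite mxE eqxx /= eq_sym.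
Qed.

Lemma has_jet_eq (R : realType) (n : nat) (U : set 'rV[R]_n)
    (f g : 'rV[R]_n -> R) (G K G' K' : 'I_n -> 'rV[R]_n -> R) :
  f =1 g -> G =2 G' -> K =2 K' -> has_jet U f G K -> has_jet U g G' K'.
Proof.
move=> fg GG KK; congr (has_jet U _ _ _); apply/funext => // i; exact/funext.
Qed.

Lemma has_jet_dot (R : realType) (n : nat) (U : set 'rV[R]_n) (e : 'rV[R]_n) :
  has_jet U (dot e) (fun i _ => e ord0 i) (fun _ _ => 0).
Proof.
have := @has_jet_sum R n U _ (index_enum 'I_n) _ _ _
  (fun j => has_jetZ (e ord0 j) (@has_jet_coord R n U j)).
apply: has_jet_eq => // [i x|i x]; last by apply: big1 => j _; rewrite mulr0.
rewrite (bigD1 i)//= eqxx mulr1 big1 ?addr0// => j.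
by rewrite eq_sym => /negbTE ->; rewrite mulr0.
Qed.

Lemma has_jet_sqnorm (R : realType) (n : nat) (U : set 'rV[R]_n) :
  has_jet U (@sqnorm R n) (fun i x => 2 * x ord0 i) (fun _ _ => 2).
Proof.
have := @has_jet_sum R n U _ (index_enum 'I_n) _ _ _
  (fun j => has_jetM (@has_jet_coord R n U j) (@has_jet_coord R n U j)).
apply: has_jet_eq => // i x.
- rewrite (bigD1 i)//= eqxx mulr1 big1 ?addr0 => [|j]; first by ring.
  by rewrite eq_sym => /negbTE ->; rewrite mulr0 addr0.
- rewrite (bigD1 i)//= eqxx big1 ?addr0 => [|j]; first by rewrite /=; ring.
  by rewrite eq_sym => /negbTE ->; rewrite !mulr0 !addr0.
Qed.

(** * The weak maximum principle *)

Lemma second_derive_max (R : realType) (f df : R -> R) (d r : R) :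
    0 < r -> (forall s : R, `|s| < r -> is_derive s 1 f (df s)) ->
    is_derive (0 : R) 1 df d -> (forall s, `|s| < r -> f s <= f 0) -> d <= 0.
Proof.
move=> r0 fd dfd fmax; rewrite leNgt; apply/negP => d0.
have inr s : s \in `](- r), r[%R -> `|s| < r.
  by rewrite in_itv/= ltr_norml.
have df0 : df 0 = 0.
  have [] : is_derive (0 : R) 1 f 0.
    apply: (@derive1_at_max R f (- r) r 0).
    - by lra.
    - by move=> t /inr tr; have [] := fd t tr.
    - by rewrite in_itv/=; lra.
    - by move=> t /inr; apply: fmax.
  have r00 : `|0 : R| < r by rewrite normr0.
  by move=> _ D0; have [_ <-] := fd 0 r00.
have [dv dE] := dfd.
have : \forall h \near 0^', 0 < h^-1 *: (df (h *: 1 + 0) - df 0).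
  apply: (cvgr_gt d) => //.
  by rewrite -dE; apply: dv.
rewrite /dnbhs/= => /nbhs_ballP[e /= e0 He].
set m := Num.min e r / 2.
have m0 : 0 < m by rewrite divr_gt0// lt_min e0.
have le_me : Num.min e r <= e by rewrite ge_min lexx.
have le_mr : Num.min e r <= r by rewrite ge_min lexx orbT.
have me : m < e by rewrite /m; lra.
have mr : m < r by rewrite /m; lra.
have pos h : 0 < h -> h < e -> 0 < df h.
  move=> h0 he; have := He h; rewrite /ball/= sub0r normrN gtr0_norm// => /(_ he).
  rewrite gt_eqF// => /(_ isT); rewrite df0 subr0 addr0 [_ *: 1]mulr1.
  by rewrite /GRing.scale/= pmulr_rgt0// invr_gt0.
have [c] : exists2 c, c \in `]0, m[%R & f m - f 0 = df c * (m - 0).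
  apply: MVT => // [x|].
    rewrite in_itv/= => /andP[x0 xm]; apply: fd.
    by rewrite gtr0_norm//; apply: lt_trans mr.
  apply: derivable_within_continuous => x; rewrite in_itv/= => /andP[x0 xm].
  have xr : `|x| < r by rewrite ger0_norm//; apply: le_lt_trans mr.
  by have [] := fd x xr.
rewrite in_itv/= => /andP[c0 cm] E.
have : 0 < f m - f 0.
  by rewrite E subr0 mulr_gt0// pos//; apply: lt_trans me.
by rewrite subr_gt0 ltNge fmax// gtr0_norm.
Qed.

Lemma weak_maximum_principle (R : realType) (n : nat) (f : 'rV[R]_n -> R)
    (G K : 'I_n -> 'rV[R]_n -> R) :
    (forall x, enorm x <= 1 -> {for x, continuous f}) ->
    has_jet [set x | enorm x < 1] f G K ->
    (forall x, enorm x < 1 -> 0 < \sum_(i < n) K i x) ->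
    (forall x, enorm x = 1 -> f x <= 0) ->
  forall x, enorm x <= 1 -> f x <= 0.
Proof.
move=> fc fj lap_gt0 f_bd x0 x01.
have [|c] := @EVT_max_rV R n f _ (ex_intro _ x0 x01) (@closed_ball_compact R n).
  by apply: continuous_in_subspaceT => x; rewrite inE; apply: fc.
rewrite inE/= => c1 cmax.
suff : f c <= 0 by apply: le_trans; apply: cmax; rewrite inE.
have [c_eq|c_neq] := eqVneq (enorm c) 1; first exact: f_bd.
have c_lt : enorm c < 1 by rewrite lt_neqAle c_neq.
suff : \sum_(i < n) K i c <= 0 by rewrite leNgt lap_gt0.
apply: sumr_le0 => i _; set v : 'rV[R]_n := delta_mx ord0 i.
have v1 : enorm v = 1.
  rewrite enormE /sqnorm (bigD1 i)//= mxE !eqxx expr1n big1 ?addr0 ?sqrtr1//.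
  by move=> j /negbTE ji; rewrite mxE ji andbF expr0n.
have near_c s : `|s| < 1 - enorm c -> enorm (c + s *: v) < 1.
  move=> s1; apply: le_lt_trans (enormD _ _) _.
  by rewrite enormZ v1 mulr1 -ltrBrDl.
apply: (@second_derive_max R (fun s => f (c + s *: v))
  (fun s => G i (c + s *: v)) (K i c) (1 - enorm c)).
- by rewrite subr_gt0.
- move=> s /near_c sc; apply/is_derive_line.
  by have [_ /(_ i)[]] := fj _ sc.
- apply/is_derive_line; rewrite scale0r addr0.
  by have [_ /(_ i)[]] := fj _ c_lt.
- move=> s /near_c sc; rewrite scale0r addr0.
  by apply: cmax; rewrite inE/= ltW.
Qed.

(** * Harmonic extension of polynomials in one coordinate *)

(** The Gegenbauer recurrence made homogeneous, with [s] of degree 1 and [q] of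
degree 2; for [s = <e, x>] and [q = |x|^2] it gives the solid zonal
harmonics. *)
Fixpoint solid_zonal_pair (R : realType) (m : nat) (s q : R) (k : nat) : R * R :=
  match k with
  | 0 => (1, 0)
  | k'.+1 => let ab := solid_zonal_pair m s q k' in
      ((k'.*2 + m.+1)%:R * (s * ab.1) - gegen_coef R m k' * (q * ab.2), ab.1)
  end.

Definition solid_zonal (R : realType) (m : nat) (e : 'rV[R]_m.+3) (k : nat)
    (x : 'rV[R]_m.+3) : R :=
  (solid_zonal_pair m (dot e x) (sqnorm x) k).1.

Lemma solid_zonalS (R : realType) (m : nat) (e : 'rV[R]_m.+3) (k : nat)
    (x : 'rV[R]_m.+3) :
  solid_zonal e k.+1 x = (k.*2 + m.+1)%:R * (dot e x * solid_zonal e k x)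
                   - gegen_coef R m k * (sqnorm x * solid_zonal e k.-1 x).
Proof. by case: k => [|k] //; rewrite /solid_zonal/= /gegen_coef mul0n !mul0r. Qed.

Lemma solid_zonal_sphere (R : realType) (m : nat) (e : 'rV[R]_m.+3) (k : nat)
    (x : 'rV[R]_m.+3) :
  sqnorm x = 1 -> solid_zonal e k x = (gegen R m k).[dot e x].
Proof.
move=> x1; suff [] : solid_zonal e k x = (gegen R m k).[dot e x] /\
  solid_zonal e k.+1 x = (gegen R m k.+1).[dot e x] by [].
elim: k => [|k [IH0 IH1]].
  rewrite solid_zonalS gegenS gegen0 [solid_zonal e 0 x]/(1) /gegen_coef mul0n mul0r.
  by rewrite scale0r !subr0 !mulr1 hornerC hornerZ hornerX.
split=> //; rewrite solid_zonalS gegenS x1 mul1r hornerD hornerN.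
by rewrite !hornerZ hornerM hornerX -IH0 -IH1.
Qed.

Lemma solid_zonal_origin (R : realType) (m : nat) (e : 'rV[R]_m.+3) (k : nat) :
  solid_zonal e k 0 = sphmean m (gegen R m k).
Proof.
case: k => [|k]; first by rewrite gegen0 sphmean1.
by rewrite sphmean_gegen solid_zonalS dotx0 sqnorm0 !mul0r !mulr0 subr0.
Qed.

(** Harmonicity alone does not pass through the recurrence.  The Laplacian of
[s Z] is [2 d_e Z], and that of [q Y] involves the radial derivative of [Y];
so the induction also carries the formula for [d_e] and Euler's identity. *)
Lemma solid_zonal_jet (R : realType) (m : nat) (e : 'rV[R]_m.+3) (k : nat) :
    sqnorm e = 1 ->
  exists G K, [/\ has_jet setT (solid_zonal e k) G K,
    forall x, \sum_(i < m.+3) K i x = 0,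
    forall x, \sum_(i < m.+3) e ord0 i * G i x
              = gegen_coef R m k * solid_zonal e k.-1 x &
    forall x : 'rV[R]_m.+3, \sum_(i < m.+3) x ord0 i * G i x = k%:R * solid_zonal e k x].
Proof.
move=> e1; pose P k := exists G K, [/\ has_jet setT (solid_zonal e k) G K,
    forall x, \sum_(i < m.+3) K i x = 0,
    forall x, \sum_(i < m.+3) e ord0 i * G i x
              = gegen_coef R m k * solid_zonal e k.-1 x &
    forall x : 'rV[R]_m.+3, \sum_(i < m.+3) x ord0 i * G i x = k%:R * solid_zonal e k x].
have P0 : P 0.
  exists (fun _ _ => 0), (fun _ _ => 0); split.
  - exact: has_jet_cst.
  - by move=> x; rewrite big1.
  - by move=> x; rewrite big1 ?/gegen_coef ?mul0n ?mul0r// => i; rewrite mulr0.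
  - by move=> x; rewrite big1 ?mul0r// => i; rewrite mulr0.
suff : P k /\ P k.+1 by case.
suff step j : P j.-1 -> P j -> P j.+1.
  by elim: k => [|j [IH0 IH1]]; split=> //; apply: step.
move=> [GY [KY [jY lY eY xY]]] [GZ [KZ [jZ lZ eZ xZ]]].
have := has_jetD
  (has_jetZ (j.*2 + m.+1)%:R (has_jetM (@has_jet_dot R _ setT e) jZ))
  (has_jetZ (- gegen_coef R m j) (has_jetM (@has_jet_sqnorm R _ setT) jY)).
set a := (j.*2 + m.+1)%:R; set g := gegen_coef R m j.
have gj : g * j.-1%:R = g * (j%:R - 1).
  rewrite /g /gegen_coef; case: (j) => [|i]; first by rewrite mul0n !mul0r.
  by rewrite -natr1 addrK.
have aE : a = 2 * j%:R + m%:R + 1 by rewrite /a -addnn; ring.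
have solE x : solid_zonal e j.+1 x = a * (dot e x * solid_zonal e j x)
    + - g * (sqnorm x * solid_zonal e j.-1 x) by rewrite solid_zonalS mulNr.
move=> jet; eexists; eexists; split.
- by apply: has_jet_eq jet => [x| |]; [rewrite solE| |].
- move=> x.
  have sum2 : \sum_(i < m.+3) 2 = 2 * m.+3%:R :> R.
    by rewrite sumr_const card_ord mulr_natr.
  transitivity (a * (dot e x * (\sum_(i < m.+3) KZ i x)
      + 2 * (\sum_(i < m.+3) e ord0 i * GZ i x))
    - g * (sqnorm x * (\sum_(i < m.+3) KY i x)
      + 4 * (\sum_(i < m.+3) x ord0 i * GY i x)
      + solid_zonal e j.-1 x * (2 * m.+3%:R))).
    rewrite -sum2 !mulr_sumr -!big_split/= !mulr_sumr -sumrB.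
    by apply: eq_bigr => i _; ring.
  rewrite lZ lY eZ xY -/g aE.
  transitivity ((4 * j%:R + 2 * m%:R + 2) * g * solid_zonal e j.-1 x
    - 4 * (g * j.-1%:R) * solid_zonal e j.-1 x
    - 2 * m.+3%:R * g * solid_zonal e j.-1 x); first by ring.
  by rewrite gj; ring.
- move=> x.
  transitivity (a * (dot e x * (\sum_(i < m.+3) e ord0 i * GZ i x) +
      solid_zonal e j x * (\sum_(i < m.+3) e ord0 i ^+ 2))
    - g * (sqnorm x * (\sum_(i < m.+3) e ord0 i * GY i x)
      + solid_zonal e j.-1 x * (2 * dot e x))).
    rewrite /dot !mulr_sumr -!big_split/= !mulr_sumr -sumrB.
    apply: eq_bigr => i _. ring.
  rewrite eZ eY -/(sqnorm e) e1 -/g.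
  rewrite /g; case: (j) aE gj => [|i] aE gj.
    rewrite /gegen_coef aE !mul0n !mul0r; ring.
  have := solid_zonalS e i x; rewrite /= => iE.
  transitivity (a * solid_zonal e i.+1 x + gegen_coef R m i.+1 *
     ((i.*2 + m.+1)%:R * (dot e x * solid_zonal e i x)
      - gegen_coef R m i * (sqnorm x * solid_zonal e i.-1 x))).
    by rewrite aE -addnn; ring.
  by rewrite -iE aE /gegen_coef; ring.
- move=> x.
  transitivity (a * (dot e x * (\sum_(i < m.+3) x ord0 i * GZ i x) +
      solid_zonal e j x * dot e x)
    - g * (sqnorm x * (\sum_(i < m.+3) x ord0 i * GY i x)
      + solid_zonal e j.-1 x * (2 * sqnorm x))).
    rewrite /dot /sqnorm !mulr_sumr -!big_split/= !mulr_sumr -sumrB.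
    apply: eq_bigr => i _. ring.
  rewrite xZ xY solE.
  transitivity (a * (dot e x * (j%:R * solid_zonal e j x) + solid_zonal e j x * dot e x) -
    ((g * j.-1%:R) * sqnorm x * solid_zonal e j.-1 x
     + 2 * g * (solid_zonal e j.-1 x * sqnorm x))); first by ring.
  by rewrite gj; ring.
Qed.

(** The polynomial [p], read on the sphere as a function of the coordinate along
[e], has a harmonic extension with the expected value at the centre. *)
Definition sphere_extends (R : realType) (m : nat) (e : 'rV[R]_m.+3)
    (p : {poly R}) : Prop :=
  exists P G K, [/\ has_jet setT P G K, forall x, \sum_(i < m.+3) K i x = 0,
    forall x, sqnorm x = 1 -> P x = p.[dot e x] & P 0 = sphmean m p].

Lemma sphere_extendsD (R : realType) (m : nat) (e : 'rV[R]_m.+3) (a : R)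
    (p q : {poly R}) :
  sphere_extends e p -> sphere_extends e q -> sphere_extends e (a *: p + q).
Proof.
move=> [P [G [K [jP lP sP oP]]]] [Q [H [L [jQ lQ sQ oQ]]]].
have jet := has_jetD (has_jetZ a jP) jQ.
eexists; eexists; eexists; split; first exact: jet.
- by move=> x; rewrite big_split/= -mulr_sumr lP lQ mulr0 addr0.
- by move=> x x1; rewrite !hornerE sP// sQ.
- by rewrite linearD/= sphmeanZ oP oQ.
Qed.

(** The induction on [p] needs a statement stable under multiplication by [X];
it is the extension of [p] times every Gegenbauer polynomial, for which the
recurrence does that multiplication. *)
Lemma sphere_extends_poly (R : realType) (m : nat) (e : 'rV[R]_m.+3)
    (p : {poly R}) :
  sqnorm e = 1 -> sphere_extends e p.
Proof.
move=> e1; have ext k : sphere_extends e (gegen R m k).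
  have [G [K [jZ lZ _ _]]] := solid_zonal_jet k e1.
  exists (solid_zonal e k), G, K; split=> //; last exact: solid_zonal_origin.
  by move=> x; apply: solid_zonal_sphere.
have ext0 : sphere_extends e 0.
  by have := sphere_extendsD (-1) (ext 0%N) (ext 0%N); rewrite scaleN1r addNr.
suff all_k : forall k, sphere_extends e (p * gegen R m k).
  by have := all_k 0%N; rewrite gegen0 mulr1.
elim/poly_ind: p => [|p c IH] k; first by rewrite mul0r.
have a0 : (k.*2 + m.+1)%:R != 0 :> R by rewrite pnatr_eq0 addnS.
have -> : (p * 'X + c%:P) * gegen R m k =
   (k.*2 + m.+1)%:R^-1 *: (p * gegen R m k.+1)
   + ((k.*2 + m.+1)%:R^-1 * gegen_coef R m k) *: (p * gegen R m k.-1)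
   + c *: gegen R m k.
  rewrite mulrDl mul_polyC; congr (_ + _).
  rewrite -scalerA -scalerDr scalerAr -mulrDr -mulX_gegen -scalerAr scalerA.
  by rewrite mulVf// scale1r mulrA.
rewrite addrC; apply: sphere_extendsD => //.
apply: sphere_extendsD => //; rewrite -[X in sphere_extends _ X]addr0.
exact: sphere_extendsD.
Qed.

(** * Radial Euler equation *)

Lemma mean_value_from0 (R : realType) (f df : R -> R) (b : R) :
    (forall s : R, `|s| <= `|b| -> is_derive s 1 f (df s)) ->
  exists2 c, `|c| <= `|b| & f b - f 0 = df c * b.
Proof.
move=> fd; have fc (a c : R) : (forall s, s \in `[a, c] -> `|s| <= `|b|) ->
    {within `[a, c], continuous f}.
  move=> ab; apply: derivable_within_continuous => s /ab sb.
  by have [] := fd s sb.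
have [b0|b0] := lerP 0 b.
  have sb s : s \in `[0, b] -> `|s| <= `|b|.
    by rewrite in_itv/= (ger0_norm b0) => /andP[s0 sb]; rewrite ger0_norm.
  have [|c /sb cb E] := @MVT_segment R f df 0 b b0 _ (fc _ _ sb).
    by move=> s /subset_itv_oo_cc/sb; apply: fd.
  by exists c; rewrite // E subr0.
have sb s : s \in `[b, 0] -> `|s| <= `|b|.
  by rewrite in_itv/= => /andP[bs s0]; rewrite !ler0_norm ?lerN2// ltW.
have [|c /sb cb E] := @MVT_segment R f df b 0 (ltW b0) _ (fc _ _ sb).
  by move=> s /subset_itv_oo_cc/sb; apply: fd.
by exists c; rewrite // -opprB E sub0r mulrN opprK.
Qed.

(** A function with continuous partial derivatives has derivatives in all
directions.  They are added one axis at a time: moving along the next axis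
changes the difference quotient by a value of one partial derivative at a
nearby point. *)
Lemma directional_derivative (R : realType) (n : nat) (U : set 'rV[R]_n)
    (f : 'rV[R]_n -> R) (G : 'I_n -> 'rV[R]_n -> R) :
    open U ->
    (forall x, U x -> forall i : 'I_n,
      is_derive x (delta_mx ord0 i : 'rV[R]_n) f (G i x) /\
      {for x, continuous (G i)}) ->
  forall x v, U x -> is_derive x v f (\sum_(i < n) v ord0 i * G i x).
Proof.
move=> oU fG x v Ux.
have step w d c j : is_derive x w f d ->
    is_derive x (w + c *: (delta_mx ord0 j : 'rV[R]_n)) f (d + c * G j x).
  move=> [fw fwd]; set ej : 'rV[R]_n := delta_mx ord0 j.
  suff lim : h^-1 *: (f (h *: (w + c *: ej) + x) - f x) @[h --> 0^']
      --> d + c * G j x.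
    split; first by apply/cvg_ex; exists (d + c * G j x).
    exact: cvg_lim.
  have -> : (fun h : R => h^-1 *: (f (h *: (w + c *: ej) + x) - f x)) =
    (fun h => h^-1 *: (f (h *: w + x) - f x)) \+
    (fun h => h^-1 *: (f (h *: (w + c *: ej) + x) - f (h *: w + x))).
    by apply/funext => h /=; rewrite -scalerDr [in RHS]addrC addrA subrK.
  apply: cvgD; first by rewrite -fwd; exact: fw.
  apply/cvgrPdist_le => eps eps0.
  have /cvgrPdist_lt/(_ (eps / (`|c| + 1))) Gc := (fG x Ux j).2.
  have c1 : 0 < `|c| + 1 by rewrite ltr_wpDl.
  have near_x : \forall y \near x, U y /\ `|G j x - G j y| < eps / (`|c| + 1).
    near=> y; split; near: y; first exact: (open_nbhs_nbhs (conj oU Ux)).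
    by apply: Gc; rewrite divr_gt0.
  have [r /= r0 Hr] := (nbhs_ballP _ _).1 near_x.
  set M := `|w| + `|c| * `|ej| + 1.
  have M0 : 0 < M by rewrite ltr_wpDl// addr_ge0// mulr_ge0.
  have h0 : \forall h \near (0 : R)^', `|h| < r / M.
    apply: cvg_within; apply/nbhs_ballP; exists (r / M); first by rewrite /= divr_gt0.
    by move=> h; rewrite /ball/= sub0r normrN.
  near=> h.
  have hr : `|h| < r / M by near: h.
  have hn0 : h != 0 by near: h; exact: nbhs_dnbhs_neq.
  have inU s : `|s| <= `|h * c| -> ball x r (h *: w + x + s *: ej).
    move=> sc; rewrite -ball_normE/= addrAC [_ + x]addrC opprD addrA subrr sub0r.
    rewrite normrN; apply: le_lt_trans (ler_normD _ _) _; rewrite !normrZ.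
    have : `|s| * `|ej| <= `|h| * (`|c| * `|ej|).
      by rewrite mulrA -normrM ler_wpM2r.
    have : `|h| * M < r by rewrite -ltr_pdivlMr.
    by rewrite /M; have := normr_ge0 h; lra.
  have [s sc E] := @mean_value_from0 R (fun s => f (h *: w + x + s *: ej))
     (fun s => G j (h *: w + x + s *: ej)) (h * c)
     (fun s sc => (is_derive_line _ _ _ _ _).1
        (fG _ (Hr _ (inU s sc)).1 j).1).
  have -> : h *: (w + c *: ej) + x = h *: w + x + (h * c) *: ej.
    by rewrite scalerDr scalerA addrAC.
  rewrite scale0r addr0 in E; rewrite E /GRing.scale/=.
  have -> : h^-1 * (G j (h *: w + x + s *: ej) * (h * c)) =
    c * G j (h *: w + x + s *: ej) by field.
  rewrite -mulrBr normrM.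
  have [_ /ltW Gs] := Hr _ (inU s sc).
  apply: (@le_trans _ _ (`|c| * (eps / (`|c| + 1)))).
    by rewrite ler_wpM2l.
  rewrite mulrA ler_pdivrMr// mulrC ler_wpM2l ?lerDl//; exact: ltW.
have : is_derive x (\sum_(i < n) v ord0 i *: (delta_mx ord0 i : 'rV[R]_n)) f
    (\sum_(i < n) v ord0 i * G i x).
  elim: (index_enum 'I_n) => [|i r IH].
    by rewrite !big_nil; exact: is_derive0.
  by rewrite !big_cons addrC [X in is_derive _ _ _ X]addrC; exact: step.
by rewrite -row_sum_delta.
Unshelve. all: by end_near. Qed.

(** The Heine-Cantor theorem; the second point may lie outside of the compact
set. *)
Lemma compact_uniformly_continuous (R : realType) (T : pseudoMetricType R)
    (A : set T) (f : T -> R) (eps : R) :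
    compact A -> (forall x, A x -> {for x, continuous f}) -> 0 < eps ->
  exists2 d : R, 0 < d &
    forall x y, A x -> ball x d y -> `|f x - f y| < eps.
Proof.
move=> /compact_near_coveringP cA fc eps0.
have := @cA R (0^'+) (fun d x => forall y, ball x d y -> `|f x - f y| < eps).
have loc x : A x -> \forall x' \near x & d \near (0 : R)^'+,
    forall y, ball x' d y -> `|f x' - f y| < eps.
  move=> Ax; have /cvgrPdist_lt/(_ _ (divr_gt0 eps0 (ltr0Sn _ 1)))/= := fc x Ax.
  move=> /nbhs_ballP[r /= r0 Hr].
  exists (ball x (r / 2), [set d | d < r / 2]) => /=.
    split; first exact: nbhsx_ballx (divr_gt0 r0 _).
    by apply: nbhs_right_lt; rewrite divr_gt0.
  move=> [x' d]/= [xx' dr] y x'y.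
  have xr : ball x r x' by apply: le_ball xx'; lra.
  have yr : ball x r y.
    by apply: ball_split xx' _; apply: le_ball x'y; exact: ltW.
  have := Hr _ xr; have := Hr _ yr => Hy Hx.
  rewrite (_ : f x' - f y = - (f x - f x') + (f x - f y)); last by ring.
  apply: le_lt_trans (ler_normD _ _) _; rewrite normrN.
  by rewrite [eps]splitr ltrD.
move=> /(_ _ loc) nearA.
have [d [d0 dA]] : exists d : R, 0 < d /\
    A `<=` (fun x => forall y, ball x d y -> `|f x - f y| < eps).
  near (0 : R)^'+ => d; exists d; split; first by near: d; exact: nbhs_right_gt.
  by near: d; exact: nearA.
by exists d => // x y /dA; apply.
Unshelve. all: by end_near. Qed.

(** The derivative in [s] of [s^(n + 1) D(s^2 y)].  The square keeps the
exponents integral in every dimension. *)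
Definition ray_derivative (R : realType) (n : nat) (D : 'rV[R]_n.+1 -> R)
    (G : 'I_n.+1 -> 'rV[R]_n.+1 -> R) (y : 'rV[R]_n.+1) (s : R) : R :=
  n.+1%:R * s ^+ n * D (0 + s ^+ 2 *: y) +
  2 * s ^+ n.+2 * \sum_(i < n.+1) y ord0 i * G i (0 + s ^+ 2 *: y).

Lemma is_derive_pow (R : realType) (k : nat) (s : R) :
  is_derive s 1 (fun r : R => r ^+ k) (k%:R * s ^+ k.-1).
Proof.
have := is_deriveX k (@is_derive_id R R s 1).
by rewrite [_ *: 1]mulr1; congr (is_derive _ _ _ _); apply/funext => r; rewrite exprfctE.
Qed.

Lemma is_derive_ray (R : realType) (n : nat) (U : set 'rV[R]_n.+1)
    (D : 'rV[R]_n.+1 -> R) (G : 'I_n.+1 -> 'rV[R]_n.+1 -> R)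
    (y : 'rV[R]_n.+1) (s : R) :
    open U ->
    (forall x, U x -> forall i : 'I_n.+1,
      is_derive x (delta_mx ord0 i : 'rV[R]_n.+1) D (G i x) /\
      {for x, continuous (G i)}) ->
    U (0 + s ^+ 2 *: y) ->
  is_derive s 1 (fun r => r ^+ n.+1 * D (0 + r ^+ 2 *: y))
    (ray_derivative D G y s).
Proof.
move=> oU DG Us.
have dD : is_derive s 1 (fun r => D (0 + r ^+ 2 *: y))
    (2 * s * \sum_(i < n.+1) y ord0 i * G i (0 + s ^+ 2 *: y)).
  rewrite mulrC; apply: (@is_derive1_comp _ (fun r => D (0 + r *: y))
    (fun r => r ^+ 2)).
    by apply/is_derive_line; exact: (directional_derivative oU DG).
  by rewrite -[2 * s]/(2%:R * s ^+ 1); exact: is_derive_pow.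
have := is_deriveM (is_derive_pow n.+1 s) dD.
congr (is_derive _ _ _ _).
by rewrite /GRing.scale/= /ray_derivative !exprS; ring.
Qed.

Lemma enorm_contract (R : realType) (n : nat) (r s : R) (y : 'rV[R]_n) :
  enorm y < r -> `|s| <= 1 -> enorm (0 + s ^+ 2 *: y) < r.
Proof.
move=> yr s1; rewrite add0r enormZ normrX; apply: le_lt_trans yr.
by rewrite ler_piMl ?enorm_ge0// exprn_ile1.
Qed.

(** If [g(s) = s^(n + 1) D(s^2 y)], the average [v(y)] of [s^n D(s^2 y)] over
[[0, 1]] satisfies [(n + 1) v + 2 y.grad v] = the integral of [g'], that is,
[g(1) - g(0) = D(y)].  A Riemann sum stands for the average, so that [v] is a
finite combination of dilations of [D] and is harmonic without any
differentiation under an integral; the mean value theorem and the uniform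
continuity of [g'] control the error. *)
Lemma euler_equation (R : realType) (n : nat) (rho eps : R)
    (D : 'rV[R]_n.+1 -> R) (G K : 'I_n.+1 -> 'rV[R]_n.+1 -> R) :
    let U := [set x | enorm x < rho] in
    1 < rho -> 0 < eps -> has_jet U D G K ->
    (forall x, U x -> forall i, {for x, continuous (G i)}) ->
    (forall x, U x -> \sum_(i < n.+1) K i x = 0) ->
  exists v H L, [/\ has_jet U v H L,
    forall x, U x -> \sum_(i < n.+1) L i x = 0 &
    forall y, enorm y <= 1 ->
      `|n.+1%:R * v y + 2 * \sum_(i < n.+1) y ord0 i * H i y - D y| <= eps].
Proof.
move=> U rho1 eps0 Dj Gc Klap.
have oU : open U by exact: open_ball_open.
have DG x : U x -> forall i : 'I_n.+1,
      is_derive x (delta_mx ord0 i : 'rV[R]_n.+1) D (G i x) /\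
      {for x, continuous (G i)}.
  by move=> Ux i; split; [have [_ /(_ i)[]] := Dj x Ux | exact: Gc].
pose A := `[0 : R, 1]%classic `*` [set y : 'rV[R]_n.+1 | enorm y <= 1].
have cA : compact A.
  by apply: compact_setX; [exact: segment_compact | exact: closed_ball_compact].
pose M (p : R * 'rV[R]_n.+1) := ray_derivative D G p.2 p.1.
have Mc p : A p -> {for p, continuous M}.
  case: p => s y [/= s01 y1].
  have Us : U (0 + s ^+ 2 *: y).
    apply: enorm_contract; first exact: le_lt_trans rho1.
    by move: s01; rewrite /= in_itv/= => /andP[s0 s1]; rewrite ger0_norm.
  have c1 k : {for (s, y), continuous (fun p : R * 'rV[R]_n.+1 => p.1 ^+ k)}.
    apply: (@continuous_comp _ _ _ fst (fun r : R => r ^+ k)).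
      exact: cvg_fst.
    exact: exprn_continuous.
  have cz : {for (s, y), continuous
      (fun p : R * 'rV[R]_n.+1 => 0 + p.1 ^+ 2 *: p.2)}.
    apply: continuousD; first exact: cst_continuous.
    by apply: cvgZ; [exact: c1 | exact: cvg_snd].
  have cf (f : 'rV[R]_n.+1 -> R) : {for 0 + s ^+ 2 *: y, continuous f} ->
    {for (s, y), continuous (fun p : R * 'rV[R]_n.+1 => f (0 + p.1 ^+ 2 *: p.2))}.
    by move=> fc; exact: (continuous_comp cz fc).
  rewrite /M /ray_derivative.
  apply: continuousD; apply: continuousM.
  - by apply: continuousM; [exact: cst_continuous | exact: c1].
  - by apply: cf; have [] := Dj _ Us.
  - by apply: continuousM; [exact: cst_continuous | exact: c1].
  - apply: continuous_sum => i; apply: continuousM; last by apply: cf; apply: Gc.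
    apply: (@continuous_comp _ _ _ snd (fun y : 'rV[R]_n.+1 => y ord0 i)).
      exact: cvg_snd.
    exact: coord_continuous.
have [d d0 Md] := compact_uniformly_continuous cA Mc eps0.
have [N N0 Nd] : exists2 N, (0 < N)%N & N%:R^-1 < d.
  have [N] := ltr_add_invr (y := 0) (x := d) d0.
  by rewrite add0r => Nd; exists N.+1.
pose h : R := N%:R^-1.
have h0 : 0 < h by rewrite invr_gt0 ltr0n.
have Nh : N%:R * h = 1 by rewrite mulfV// pnatr_eq0 -lt0n.
pose tau (j : nat) : R := j%:R * h.
have tau01 j : (j <= N)%N -> 0 <= tau j <= 1.
  move=> jN; rewrite mulr_ge0 ?ler0n ?(ltW h0)//=.
  by rewrite -Nh ler_pM2r// ler_nat.
pose a (j : 'I_N) := tau j.+1 ^+ 2.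
have Ua (j : 'I_N) x : U x -> U (0 + a j *: x).
  move=> Ux; apply: enorm_contract => //.
  by have /andP[t0 t1] := tau01 j.+1 (ltn_ord j); rewrite ger0_norm.
have vj := @has_jet_sum R n.+1 U 'I_N (index_enum 'I_N) _ _ _
  (fun j => has_jetZ (h * tau j.+1 ^+ n) (has_jet_affine Dj (Ua j))).
eexists; eexists; eexists; split; first exact: vj.
  move=> x Ux; rewrite exchange_big/= big1// => j _.
  by rewrite -!mulr_sumr Klap ?mulr0//; exact: Ua.
move=> y y1.
have Uy (s : R) : 0 <= s <= 1 -> U (0 + s ^+ 2 *: y).
  move=> /andP[s0 s1]; apply: enorm_contract; first exact: le_lt_trans rho1.
  by rewrite ger0_norm.
pose g r := r ^+ n.+1 * D (0 + r ^+ 2 *: y).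
have gd (s : R) : 0 <= s <= 1 -> is_derive s 1 g (ray_derivative D G y s).
  by move=> s01; apply: is_derive_ray oU DG _; exact: Uy.
have DE : D y = \sum_(j < N) (g (tau j.+1) - g (tau j)).
  rewrite -(big_mkord xpredT (fun j => g (tau j.+1) - g (tau j))).
  rewrite telescope_sumr// /g /tau Nh mul0r !expr1n scale1r add0r mul1r.
  by rewrite expr0n mul0r subr0.
have -> : n.+1%:R * (\sum_(j <- index_enum 'I_N)
      h * tau j.+1 ^+ n * D (0 + a j *: y)) +
    2 * (\sum_(i < n.+1) y ord0 i * (\sum_(j <- index_enum 'I_N)
      h * tau j.+1 ^+ n * (a j * G i (0 + a j *: y)))) =
    \sum_(j < N) h * ray_derivative D G y (tau j.+1).
  under [in X in _ + X]eq_bigr => i _ do rewrite mulr_sumr.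
  rewrite exchange_big/= !mulr_sumr -big_split/=; apply: eq_bigr => j _.
  rewrite /ray_derivative -/(a j) mulrDr; congr (_ + _); first by ring.
  rewrite !mulr_sumr; apply: eq_bigr => i _.
  by rewrite /a !exprS; ring.
rewrite DE -sumrB; apply: le_trans (ler_norm_sum _ _ _) _.
have -> : eps = \sum_(j < N) h * eps.
  by rewrite sumr_const card_ord -mulr_natl mulrA Nh mul1r.
apply: ler_sum => j _.
have tj : tau j <= tau j.+1 by rewrite ler_pM2r// ler_nat.
have /andP[tj0 _] := tau01 j (ltnW (ltn_ord j)).
have /andP[_ tj1] := tau01 j.+1 (ltn_ord j).
have in01 (s : R) : tau j <= s <= tau j.+1 -> 0 <= s <= 1.
  by move=> /andP[s0 s1]; rewrite (le_trans tj0 s0) (le_trans s1 tj1).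
have [|s|c] := @MVT_segment R g (ray_derivative D G y) _ _ tj.
- by move=> s /subset_itv_oo_cc; rewrite in_itv/= => /in01; exact: gd.
- apply: derivable_within_continuous => {}s; rewrite in_itv/= => /in01 s01.
  by have [] := gd s s01.
rewrite in_itv/= => cj ->.
have -> : tau j.+1 - tau j = h by rewrite /tau -natr1; ring.
rewrite mulrC -mulrBl normrM (gtr0_norm h0) mulrC ler_pM2l//.
apply: ltW; have := Md (tau j.+1, y) (c, y); apply.
  by split => //=; rewrite in_itv/= tj1 (le_trans tj0 tj).
split=> /=; last exact: ballxx.
rewrite /ball/= ltr_distlC; move: cj => /andP[cj0 cj1].
have : tau j.+1 - tau j = h by rewrite /tau -natr1; ring.
by move=> E; have := Nd; rewrite -/h; lra.
Qed.

(** [euler_equation] for a difference quotient of [u] along [e], which is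
harmonic on a slightly smaller ball and close to the derivative of [u] along
[e]. *)
Lemma approx_gradient_field (R : realType) (n : nat) (rho eps : R)
    (u : 'rV[R]_n.+1 -> R) (G K : 'I_n.+1 -> 'rV[R]_n.+1 -> R)
    (e : 'rV[R]_n.+1) :
    let U := [set x | enorm x < rho] in
    1 < rho -> 0 < eps -> enorm e = 1 -> has_jet U u G K ->
    (forall x, U x -> forall i, {for x, continuous (G i)}) ->
    (forall x, U x -> \sum_(i < n.+1) K i x = 0) ->
  exists v H L rho', [/\ 1 < rho' <= rho,
    has_jet [set x | enorm x < rho'] v H L,
    forall x, enorm x < rho' -> \sum_(i < n.+1) L i x = 0 &
    forall y, enorm y <= 1 ->
      `|n.+1%:R * v y + 2 * \sum_(i < n.+1) y ord0 i * H i y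
        - \sum_(i < n.+1) e ord0 i * G i y| <= eps].
Proof.
move=> U rho1 eps0 e1 uj Gc Klap.
have oU : open U by exact: open_ball_open.
have uG x : U x -> forall i : 'I_n.+1,
      is_derive x (delta_mx ord0 i : 'rV[R]_n.+1) u (G i x) /\
      {for x, continuous (G i)}.
  by move=> Ux i; split; [have [_ /(_ i)[]] := uj x Ux | exact: Gc].
pose Ge y := \sum_(i < n.+1) e ord0 i * G i y.
have eps2 : 0 < eps / 2 by rewrite divr_gt0.
have Gec x : enorm x <= 1 -> {for x, continuous Ge}.
  move=> x1; apply: continuous_sum => i.
  apply: continuousM; first exact: cst_continuous.
  by apply: Gc; exact: le_lt_trans rho1.
have [d1 d10 Gd] :=
  compact_uniformly_continuous (@closed_ball_compact R n.+1) Gec eps2.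
pose rho' := (1 + rho) / 2.
have rho'1 : 1 < rho' by rewrite /rho'; lra.
have M0 : 0 < `|e| + 1 by rewrite ltr_wpDl.
pose d := Num.min ((rho - 1) / 4) (d1 / (`|e| + 1) / 2).
have d0 : 0 < d by rewrite lt_min !divr_gt0 ?subr_gt0.
have d_rho : d <= (rho - 1) / 4 by rewrite ge_min lexx.
have d_d1 : d * (`|e| + 1) < d1.
  rewrite -ltr_pdivlMr//; apply: (@le_lt_trans _ _ (d1 / (`|e| + 1) / 2)).
    by rewrite ge_min lexx orbT.
  by have : 0 < d1 / (`|e| + 1); [rewrite divr_gt0 | lra].
have shiftU y s : enorm y < rho' -> `|s| <= d -> U (y + s *: e).
  move=> y1 sd; rewrite /U/=; apply: le_lt_trans (enormD _ _) _.
  by rewrite enormZ e1 mulr1; move: y1; rewrite /rho'; lra.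
pose U' := [set x : 'rV[R]_n.+1 | enorm x < rho'].
have U'U : U' `<=` U by move=> x /=; rewrite /U' /U /rho' /=; lra.
have shift1 y : U' y -> U (d *: e + 1 *: y).
  by move=> y1; rewrite scale1r addrC; apply: shiftU; rewrite // gtr0_norm.
pose D y := d^-1 * (u (d *: e + 1 *: y) + -1 * u y).
have Dj := has_jetZ d^-1 (has_jetD (has_jet_affine uj shift1)
  (has_jetZ (-1) (has_jet_sub U'U uj))).
have [||v [H [L [vj Llap vE]]]] := euler_equation rho'1 eps2 Dj.
- move=> x Ux i; apply: continuousM; first exact: cst_continuous.
  apply: continuousD; apply: continuousM; try exact: cst_continuous.
    have ac : {for x, continuous (fun y : 'rV[R]_n.+1 => d *: e + 1 *: y)}.
      by apply: continuousD; [exact: cst_continuous|exact: scaler_continuous].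
    by apply: (continuous_comp ac); apply: Gc; exact: shift1.
  by apply: Gc; exact: U'U.
- move=> x Ux; rewrite -mulr_sumr big_split/= -!mulr_sumr.
  by rewrite !Klap ?mulr0 ?addr0 ?mulr0//; [exact: U'U | exact: shift1].
exists v, H, L, rho'; split=> //.
  by rewrite rho'1 /rho' /=; lra.
move=> y y1.
have DG : `|D y - Ge y| <= eps / 2.
  have y1' : enorm y < rho' by exact: le_lt_trans rho'1.
  have [s|c cd] := @mean_value_from0 R (fun s => u (y + s *: e))
    (fun s => Ge (y + s *: e)) d.
    rewrite (gtr0_norm d0) => sd; apply/is_derive_line.
    by apply: (directional_derivative oU uG); exact: shiftU.
  rewrite scale0r addr0 => E.
  have -> : D y = Ge (y + c *: e).
    rewrite /D scale1r addrC [d *: e + y]addrC addrC mulN1r E mulrC mulfK//.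
    by rewrite gt_eqF.
  rewrite distrC ltW// Gd// -ball_normE/= opprD addrA subrr sub0r normrN normrZ.
  apply: le_lt_trans d_d1; rewrite (gtr0_norm d0) in cd.
  by apply: ler_pM => //; rewrite lerDl.
have := vE y y1; rewrite -/(D y) => vD.
rewrite -[X in `|X|](subrKA (D y)) [eps]splitr.
by apply: le_trans (ler_normD _ _) _; exact: lerD.
Qed.

(** * The gradient at the centre of a ball *)

(** In the maximum principle for [(s - t) u + (1 - |y|^2) v - P], the error made
on [v] is absorbed by a small multiple of [|y|^2 - 1], which vanishes on the
sphere and has a positive Laplacian. *)
Lemma center_derivative_le (R : realType) (m : nat) (rho t : R)
    (u : 'rV[R]_m.+3 -> R) (G K : 'I_m.+3 -> 'rV[R]_m.+3 -> R)
    (e : 'rV[R]_m.+3) (p : {poly R}) :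
    let U := [set x | enorm x < rho] in
    1 < rho -> enorm e = 1 -> has_jet U u G K ->
    (forall x, U x -> forall i, {for x, continuous (G i)}) ->
    (forall x, U x -> \sum_(i < m.+3) K i x = 0) ->
    (forall x, enorm x <= 1 -> `|u x| <= 1) ->
    (forall s, -1 <= s <= 1 -> `|s - t| <= p.[s]) ->
  (\sum_(i < m.+3) e ord0 i * G i 0) / m.+3%:R - t * u 0 <= sphmean m p.
Proof.
move=> U rho1 e1 uj Gc Klap u1 pt.
have e1' : sqnorm e = 1 by rewrite -enorm_sqr e1 expr1n.
have [P [GP [KP [Pj Plap Psph P0]]]] := sphere_extends_poly p e1'.
apply/ler_addgt0Pr => eps0 eps00; set eps := eps0 / 3.
have eps_gt0 : 0 < eps by rewrite divr_gt0.
have [v [H [L [rho' [/andP[rho'1 rho'_le] vj Llap vE]]]]] :=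
  approx_gradient_field rho1 eps_gt0 e1 uj Gc Klap.
pose U' := [set x : 'rV[R]_m.+3 | enorm x < rho'].
have U'U : U' `<=` U by move=> x /= xr; exact: lt_le_trans rho'_le.
have PU' : U' `<=` setT by [].
have Fj := has_jetD (has_jetD (has_jetD
   (has_jetM (has_jet_sub U'U uj)
      (has_jetD (@has_jet_dot R _ U' e) (@has_jet_cst R _ U' (- t))))
   (has_jetM (has_jetD (@has_jet_cst R _ U' 1)
      (has_jetZ (-1) (@has_jet_sqnorm R _ U'))) vj))
   (has_jetZ (-1) (has_jet_sub PU' Pj)))
   (has_jetZ (2 * eps) (has_jetD (@has_jet_sqnorm R _ U')
      (@has_jet_cst R _ U' (-1)))).
have ballU' : [set x | enorm x < 1] `<=` U'.
  by move=> x /= x1; exact: lt_trans rho'1.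
have Fc x (x1 : enorm x <= 1) := (Fj x (le_lt_trans x1 rho'1)).1.
pose KF i (x : 'rV[R]_m.+3) :=
  u x * (0 + 0) + 2 * (G i x * (e ord0 i + 0)) + (dot e x - t) * K i x +
  ((1 + -1 * sqnorm x) * L i x + 2 * ((0 + -1 * (2 * x ord0 i)) * H i x) +
   v x * (0 + -1 * 2)) + -1 * KP i x + 2 * eps * (2 + 0).
have lap_gt0 x : enorm x < 1 -> 0 < \sum_(i < m.+3) KF i x.
  move=> x1; have xU' : U' x := ballU' x x1.
  have := vE x (ltW x1); set Ge := \sum_(i < _) e ord0 i * _.
  set E := \sum_(i < _) x ord0 i * _; rewrite ler_norml => /andP[_ vE2].
  have const2 : \sum_(i < m.+3) 2 = 2 * m.+3%:R :> R.
    by rewrite sumr_const card_ord mulr_natr.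
  have -> : \sum_(i < m.+3) KF i x =
    2 * Ge + (dot e x - t) * (\sum_(i < m.+3) K i x) +
     (1 - sqnorm x) * (\sum_(i < m.+3) L i x) - 4 * E
     - v x * (2 * m.+3%:R) - (\sum_(i < m.+3) KP i x)
     + 2 * eps * (2 * m.+3%:R).
    rewrite -const2 /Ge /E !mulr_sumr -!big_split/= -!sumrB -!big_split/=.
    by apply: eq_bigr => i _; rewrite /KF; ring.
  rewrite Klap ?Llap ?Plap//; last exact: U'U.
  have n2 : 2 <= m.+3%:R :> R by rewrite ler_nat.
  have : 0 <= eps * (m.+3%:R - 2) by rewrite mulr_ge0 ?subr_ge0// ltW.
  lra.
have F_bd x : enorm x = 1 -> u x * (dot e x - t) +
    (1 + -1 * sqnorm x) * v x + -1 * P x + 2 * eps * (sqnorm x - 1) <= 0.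
  move=> x1; have sx : sqnorm x = 1 by rewrite -enorm_sqr x1 expr1n.
  rewrite Psph// sx.
  have dx : -1 <= dot e x <= 1.
    have := dot_le e x; rewrite e1 x1 mulr1 => ->.
    have := dot_le (-1 *: e) x; rewrite dotC dotZr dotC enormZ e1 x1.
    by rewrite normrN1 !mulr1 mulN1r andbT lerNl.
  have : u x * (dot e x - t) <= p.[dot e x].
    apply: le_trans (ler_norm _) _; rewrite normrM.
    apply: le_trans (pt _ dx); rewrite ler_piMl// u1// x1//.
  by lra.
have o1 : enorm (0 : 'rV[R]_m.+3) <= 1 by rewrite enormE sqnorm0 sqrtr0.
have := weak_maximum_principle Fc (has_jet_sub ballU' Fj) lap_gt0 F_bd o1.
rewrite dotx0 sqnorm0 P0.
have := vE 0; rewrite enormE sqnorm0 sqrtr0 => /(_ ler01).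
rewrite [X in 2 * X]big1 ?mulr0 ?addr0 => [|i _]; last by rewrite mxE mul0r.
set Ge := \sum_(i < _) _; rewrite ler_norml => /andP[vG _] F0.
have n0 : 0 < m.+3%:R :> R by rewrite ltr0n.
have : Ge / m.+3%:R <= v 0 + eps / m.+3%:R.
  rewrite ler_pdivrMr// mulrDl divfK ?gt_eqF//; lra.
have : eps / m.+3%:R <= eps.
  by rewrite ler_pdivrMr// ler_peMr ?(ltW eps_gt0)// ler1n.
have -> : eps0 = 3 * eps by rewrite /eps; field.
move: F0; move: (Ge / _) (eps / _) => A B; lra.
Qed.

(** The choice [t = - u(0)] minimizes [(1 + t^2) / 2 + t u(0)]. *)
Lemma center_gradient_le (R : realType) (m : nat) (rho : R)
    (u : 'rV[R]_m.+3 -> R) (G K : 'I_m.+3 -> 'rV[R]_m.+3 -> R)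
    (e : 'rV[R]_m.+3) :
    let U := [set x | enorm x < rho] in
    1 < rho -> enorm e = 1 -> has_jet U u G K ->
    (forall x, U x -> forall i, {for x, continuous (G i)}) ->
    (forall x, U x -> \sum_(i < m.+3) K i x = 0) ->
    (forall x, enorm x <= 1 -> -1 < u x < 1) ->
  \sum_(i < m.+3) e ord0 i * G i 0 <=
  m.+3%:R / 2 * (1 - u 0 ^+ 2) - m%:R * ((1 - `|u 0|) ^+ 2 / 4).
Proof.
move=> U rho1 e1 uj Gc Klap u1; set t := - u 0.
have o1 : enorm (0 : 'rV[R]_m.+3) <= 1 by rewrite enormE sqnorm0 sqrtr0.
have t1 : -1 < t < 1 by have := u1 0 o1; rewrite /t; lra.
have u1' x : enorm x <= 1 -> `|u x| <= 1.
  by move=> /u1; rewrite ler_norml => /andP[/ltW -> /ltW ->].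
have n0 : 0 < m.+3%:R :> R by rewrite ltr0n.
set c := (1 - `|u 0|) ^+ 2 / 4; set Ge := \sum_(i < _) _.
have bound N : (0 < N)%N -> Ge / m.+3%:R + u 0 ^+ 2 <=
    (1 + u 0 ^+ 2) / 2 - c * (m%:R / m.+3%:R) + 2 / N%:R.
  move=> N0; have [p [pt Lp]] := exists_majorant m N0 t1.
  have := center_derivative_le rho1 e1 uj Gc Klap u1' pt.
  rewrite -/Ge mulNr opprK -expr2 => /le_trans; apply.
  by move: Lp; rewrite /t sqrrN normrN -/c.
have : Ge / m.+3%:R + u 0 ^+ 2 <= (1 + u 0 ^+ 2) / 2 - c * (m%:R / m.+3%:R).
  apply/ler_addgt0Pr => eps eps0.
  have [N] := ltr_add_invr (y := 0) (x := eps / 2) (divr_gt0 eps0 (ltr0Sn R 1)).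
  rewrite add0r => Neps; apply: le_trans (bound N.+1 isT) _.
  by rewrite lerD2l -ler_pdivlMl// mulrC ltW.
rewrite -lerBrDr ler_pdivrMr// => /le_trans; apply.
rewrite le_eqVlt; apply/orP; left; apply/eqP.
have {1}-> : m%:R = m.+3%:R - 3 :> R by rewrite -!natr1; ring.
have -> : m%:R = m.+3%:R - 3 :> R by rewrite -!natr1; ring.
by field; rewrite gt_eqF.
Qed.

(** Radii [r < 1 - |x|] leave room for [u(y) = h(x + r y)] to be harmonic beyond
the closed unit ball; the bound is then extended to [r = 1 - |x|]. *)
Lemma harmonic_gradient_bound (R : realType) (m : nat)
    (h : 'rV[R]_m.+3 -> R) (x : 'rV[R]_m.+3) :
    (forall x, unit_ball R m.+3 x -> -1 < h x < 1) ->
    harmonic_on (unit_ball R m.+3) h -> unit_ball R m.+3 x ->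
  (1 - enorm x) * enorm (grad h x) <=
  m.+3%:R / 2 * (1 - h x ^+ 2) - m%:R * ((1 - `|h x|) ^+ 2 / 4).
Proof.
move=> h1 [[hC1 hC2] hlap] x1; set B := (X in _ <= X).
have hj : has_jet (unit_ball R m.+3) h (fun i => partial i h)
    (fun i => partial i (partial i h)).
  move=> y y1; split; first by have [] := hC1 y y1.
  move=> i; split; apply: derivableP; first by have [_ /(_ i)[]] := hC1 y y1.
  by have [_ /(_ i)[]] := hC2 i y y1.
have hc y : unit_ball R m.+3 y -> forall i, {for y, continuous (partial i h)}.
  by move=> y1 i; have [] := hC2 i y y1.
have [g0|g0] := eqVneq (enorm (grad h x)) 0.
  have /andP[hl hr] := h1 x x1.
  have ah1 : `|h x| < 1 by rewrite ltr_norml hl hr.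
  rewrite g0 mulr0 /B -(real_normK (num_real (h x))).
  have := normr_ge0 (h x); move: ah1; move: (`|h x|) => a a1 a0.
  have -> : m.+3%:R = m%:R + 3 :> R by rewrite -!natr1; ring.
  have : 0 <= m%:R :> R by [].
  move: (m%:R : R) => k k0.
  have : 0 <= k * ((1 - a) * (2 * (1 + a) - (1 - a))).
    by rewrite !mulr_ge0 //; lra.
  nra.
have g_gt0 : 0 < enorm (grad h x) by rewrite lt_def g0 enorm_ge0.
set e := (enorm (grad h x))^-1 *: grad h x.
have e1 : enorm e = 1.
  by rewrite enormZ ger0_norm ?invr_ge0 ?enorm_ge0// mulVf.
have x_lt1 : 0 < 1 - enorm x by rewrite subr_gt0.
have bound r : 0 < r -> r < 1 - enorm x -> r * enorm (grad h x) <= B.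
  move=> r0 rx; set rho := (1 - enorm x) / r.
  have rho1 : 1 < rho by rewrite ltr_pdivlMr// mul1r.
  have inball y : enorm y < rho -> unit_ball R m.+3 (x + r *: y).
    move=> yr; rewrite /unit_ball/=; apply: le_lt_trans (enormD _ _) _.
    by rewrite enormZ (gtr0_norm r0) -ltrBrDl mulrC -ltr_pdivlMr.
  have uj := has_jet_affine hj inball.
  have := center_gradient_le rho1 e1 uj; rewrite /= scaler0 addr0 -/B => uB.
  have -> : r * enorm (grad h x) =
      \sum_(i < m.+3) e ord0 i * (r * partial i h x).
    transitivity (r * dot e (grad h x)).
      rewrite dotC dotZr (_ : dot _ _ = enorm (grad h x) ^+ 2).
        by rewrite expr2 mulKf.
      by rewrite enorm_sqr; apply: eq_bigr => i _; rewrite expr2.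
    rewrite mulr_sumr; apply: eq_bigr => i _.
    by rewrite mulrCA [grad h x ord0 i]mxE.
  apply: uB => [y yr i|y yr|y y1].
  - apply: continuousM; first exact: cst_continuous.
    have ac : {for y, continuous (fun z : 'rV[R]_m.+3 => x + r *: z)}.
      by apply: continuousD; [exact: cst_continuous|exact: scaler_continuous].
    by apply: (continuous_comp ac); apply: hc; exact: inball.
  - have := hlap _ (inball y yr); rewrite /laplacian => lap0.
    by rewrite -!mulr_sumr lap0 !mulr0.
  - by apply: h1; apply: inball; exact: le_lt_trans rho1.
have B_gt0 : 0 < B.
  apply: lt_le_trans (bound ((1 - enorm x) / 2) _ _); last by lra.
    by rewrite mulr_gt0// divr_gt0.
  by rewrite divr_gt0.
(* if the bound failed at the full radius, it would fail at a smaller one *)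
rewrite leNgt; apply/negP => B_lt.
have q_lt : B / enorm (grad h x) < 1 - enorm x by rewrite ltr_pdivrMr.
have q_gt0 : 0 < B / enorm (grad h x) by rewrite divr_gt0.
have := bound ((B / enorm (grad h x) + (1 - enorm x)) / 2).
rewrite -ler_pdivlMr//; move: q_lt q_gt0; move: (B / _) (enorm x) => q d.
move=> qd q0 qB; have : (q + (1 - d)) / 2 <= q by apply: qB; lra.
lra.
Qed.

Theorem theorem2p5 (R : realType) (n : nat) (hn : (3 <= n)%N)
    (h : 'rV[R]_n -> R)
    (h_range : forall x : 'rV[R]_n, unit_ball R n x -> -1 < h x < 1)
    (h_harm : harmonic_on (unit_ball R n) h) :
  (forall x : 'rV[R]_n, unit_ball R n x ->
     enorm (grad h x) <= n%:R / 2 * ((1 - `|h x| ^+ 2) / (1 - enorm x))) /\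
  ((4 <= n)%N -> forall x : 'rV[R]_n, unit_ball R n x ->
     enorm (grad h x) < n%:R / 2 * ((1 - `|h x| ^+ 2) / (1 - enorm x))).
Proof.
case: n hn h h_range h_harm => [|[|[|m]]] // _ h h_range h_harm.
have gap x : unit_ball R m.+3 x -> 0 < (1 - `|h x|) ^+ 2 / 4.
  move=> /h_range/andP[hl hr].
  by rewrite divr_gt0// exprn_gt0// subr_gt0 ltr_norml hl hr.
have bound x : unit_ball R m.+3 x -> enorm (grad h x) * (1 - enorm x) <=
    m.+3%:R / 2 * (1 - `|h x| ^+ 2) - m%:R * ((1 - `|h x|) ^+ 2 / 4).
  move=> x1; rewrite mulrC real_normK ?num_real//.
  exact: harmonic_gradient_bound.
split=> [x x1|m1 x x1].
  rewrite mulrA ler_pdivlMr ?subr_gt0//; apply: le_trans (bound x x1) _.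
  by rewrite gerBl mulr_ge0//; exact/ltW/gap.
rewrite mulrA ltr_pdivlMr ?subr_gt0//; apply: le_lt_trans (bound x x1) _.
by rewrite gtrBl mulr_gt0 ?gap// ltr0n.
Qed.
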